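(* There exist an analytic function $g$ in $\mathbb{D}$ and a quasiconformal mapping $\phi$ of $\mathbb{D}$ onto $\mathbb{D}$ such that $f=g\circ\phi\in\mathcal{H}^1_{qr}$ and $\phi^{-1}|_{\mathbb{T}}$ is Lipschitz, but $g\notin\mathcal{H}^1$.
   Context: $\mathbb{D}=\{z\in\mathbb{C}:|z|<1\}$ and $\mathbb{T}=\partial\mathbb{D}$. For $K\ge 1$, a mapping $f:\mathbb{D}\to\mathbb{R}^2$ is $K$-quasiregular if $f$ belongs to the Sobolev space $W^{1,2}_{loc}(\mathbb{D},\mathbb{R}^2)$ and $|Df(z)|^2\le K\,Jf(z)$ for almost every $z\in\mathbb{D}$, where $|Df|$ is the operator norm of the differential and $Jf$ is the Jacobian determinant; as usual, $f$ denotes the continuous representative. It is $K$-quasiconformal if in addition it is a homeomorphism onto its image. Quasiregular (quasiconformal) means $K$-quasiregular ($K$-quasiconformal) for some $K\ge 1$. $\mathcal{H}^1$ is the set of analytic functions $f$ in $\mathbb{D}$, and $\mathcal{H}^1_{qr}$ the set of quasiregular mappings $f:\mathbb{D}\to\mathbb{R}^2=\mathbb{C}$, such that $$\sup_{0<r<1}\frac{1}{2\pi}\int_0^{2\pi}|f(re^{i\theta})|\,d\theta<\infty .$$ A quasiconformal mapping $\phi$ of $\mathbb{D}$ onto $\mathbb{D}$ extends to a homeomorphism of $\overline{\mathbb{D}}$ onto itself, still denoted $\phi$; $\phi^{-1}|_{\mathbb{T}}:\mathbb{T}\to\mathbb{T}$ is the restriction to $\mathbb{T}$ of the inverse of this extension.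 *)

(* Defs.v *)
From HB Require Import structures.
From mathcomp Require Import all_boot all_order all_algebra.
From mathcomp Require Import all_classical all_reals all_analysis.
From mathcomp.real_closed Require Import complex.
Set Implicit Arguments.
Unset Strict Implicit.
Unset Printing Implicit Defensive.
Import Order.TTheory GRing.Theory Num.Theory numFieldNormedType.Exports.
Import Normc.
Local Open Scope classical_set_scope.
Local Open Scope complex_scope.
Local Open Scope ring_scope.

(* [R[i]^o] is C as a normed space over itself, so that [derivable] on it is
   complex differentiability.  Mappings of the disc are total functions whose
   values outside the disc are never used. *)

Definition unit_disc (R : realType) : set R[i]^o := [set z | normc z < 1].

Definition closed_unit_disc (R : realType) : set R[i]^o :=
  [set z | normc z <= 1].

Definition unit_circle (R : realType) : set R[i]^o := [set z | normc z = 1].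

Arguments unit_disc R : clear implicits.
Arguments closed_unit_disc R : clear implicits.
Arguments unit_circle R : clear implicits.

Definition analytic (R : realType) (g : R[i]^o -> R[i]^o) : Prop :=
  forall z, unit_disc R z -> derivable g z 1.

(* Sobolev spaces and Lebesgue measure live on R * R, identified with C. *)

Definition complex_of (R : realType) (p : R * R) : R[i]^o := p.1 +i* p.2.

Definition disc (R : realType) : set (R * R) :=
  @complex_of R @^-1` unit_disc R.

Arguments disc R : clear implicits.

Definition area (R : realType) :=
  (@lebesgue_measure R \x @lebesgue_measure R)%E.

Arguments area R : clear implicits.

Definition basis_vector (R : realType) (j : 'I_2) : R * R :=
  if j == 0 then (1, 0) else (0, 1).

Arguments basis_vector R j : clear implicits.

Fixpoint Ck (R : realType) (n : nat) (u : R * R -> R) : Prop :=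
  continuous u /\
  if n is m.+1 then
    forall j, (forall p, derivable u p (basis_vector R j)) /\
              Ck m (fun p => 'D_(basis_vector R j) u p)
  else True.

Definition test_function (R : realType) (u : R * R -> R) : Prop :=
  let supp := closure [set p | u p != 0] in
  [/\ forall n, Ck n u, compact supp & supp `<=` disc R].

(* Measurability is Borel measurability: every class of Lebesgue measurable
   functions modulo null sets has a Borel representative. *)
Definition L2loc (R : realType) (u : R * R -> R) : Prop :=
  @measurable_fun _ _ (measurableTypeR R * measurableTypeR R)%type R
    (disc R) u /\
  forall K : set (R * R), compact K -> K `<=` disc R ->
    (\int[area R]_(p in K) (u p ^+ 2)%:E < +oo)%E.

Definition weak_partial (R : realType) (j : 'I_2) (u w : R * R -> R) : Prop :=
  forall h, test_function h ->
    \int[area R]_(p in disc R) (u p * 'D_(basis_vector R j) h p) =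
    - \int[area R]_(p in disc R) (w p * h p).

Definition component (R : realType) (f : R[i]^o -> R[i]^o) (i : 'I_2)
    (p : R * R) : R :=
  if i == 0 then complex.Re (f (complex_of p))
  else complex.Im (f (complex_of p)).

(* [f] is in W^{1,2}_loc, with weak differential [Df]. *)
Definition W12loc (R : realType) (f : R[i]^o -> R[i]^o)
    (Df : R * R -> 'M[R]_2) : Prop :=
  forall i, L2loc (component f i) /\
  forall j, L2loc (fun p => Df p i j) /\
            weak_partial j (component f i) (fun p => Df p i j).

(* The library norm on matrices is the max norm. *)
Definition euclidean_norm (R : realType) (v : 'cV[R]_2) : R :=
  Num.sqrt (\sum_i v i 0 ^+ 2).

Definition operator_norm (R : realType) (A : 'M[R]_2) : R :=
  sup [set euclidean_norm (A *m v) | v in [set v | euclidean_norm v <= 1]].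

(* [f] itself is required to be the continuous representative; [Df] is unique
   up to a null set, so its choice is immaterial. *)
Definition K_quasiregular (R : realType) (K : R) (f : R[i]^o -> R[i]^o) :
    Prop :=
  {within unit_disc R, continuous f} /\
  exists2 Df : R * R -> 'M[R]_2, W12loc f Df &
    {ae area R, forall p, disc R p ->
       operator_norm (Df p) ^+ 2 <= K * \det (Df p)}.

Definition quasiregular (R : realType) (f : R[i]^o -> R[i]^o) : Prop :=
  exists2 K : R, 1 <= K & K_quasiregular K f.

Definition homeomorphic_inverses (R : realType) (A B : set R[i]^o)
    (f h : R[i]^o -> R[i]^o) : Prop :=
  [/\ {within A, continuous f}, {within B, continuous h},
      (forall z, A z -> B (f z) /\ h (f z) = z) &
      (forall w, B w -> A (h w) /\ f (h w) = w)].

Definition K_quasiconformal (R : realType) (K : R) (f : R[i]^o -> R[i]^o) :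
    Prop :=
  K_quasiregular K f /\
  exists h, homeomorphic_inverses (unit_disc R) (f @` unit_disc R) f h.

Definition quasiconformal (R : realType) (f : R[i]^o -> R[i]^o) : Prop :=
  exists2 K : R, 1 <= K & K_quasiconformal K f.

(* [Phi] is the homeomorphic extension of [phi] to the closed disc; it is
   determined there by [phi], and so is its inverse [Psi]. *)
Definition closed_disc_extension (R : realType)
    (phi Phi Psi : R[i]^o -> R[i]^o) : Prop :=
  homeomorphic_inverses (closed_unit_disc R) (closed_unit_disc R) Phi Psi /\
  forall z, unit_disc R z -> Phi z = phi z.

Definition circle_mean (R : realType) (f : R[i]^o -> R[i]^o) (r : R) : \bar R :=
  ((2 * pi)^-1%:E * \int[@lebesgue_measure R]_(t in `[0%R, (2 * pi)%R])
     (normc (f (r%:C * (cos t +i* sin t))))%:E)%E.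

Definition bounded_circle_means (R : realType) (f : R[i]^o -> R[i]^o) : Prop :=
  (ereal_sup [set circle_mean f r | r in [set r : R | (0 < r < 1)%R]] < +oo)%E.

Definition H1 (R : realType) (f : R[i]^o -> R[i]^o) : Prop :=
  analytic f /\ bounded_circle_means f.

Definition H1qr (R : realType) (f : R[i]^o -> R[i]^o) : Prop :=
  quasiregular f /\ bounded_circle_means f.

(* Main.v *)
(* Let W(z) = (1 + z) / (1 - z) map the disc onto the right half-plane, and let
   P(u) = u |u|^(-2/3), whose inverse is Q(u) = u |u|^2.  The radial stretch P
   is quasiconformal: its derivatives with respect to u and its conjugate have
   moduli (2/3) |u|^(-2/3) and (1/3) |u|^(-2/3).  Put phi = W^-1 o P o W and
   g = W^2.  Then |g o phi| = |P(W)|^2 = |W|^(2/3) has only a singularity of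
   order 2/3 at z = 1, integrable on circles uniformly in the radius, while
   |g| = |W|^2 exceeds a constant times (1 - r)^(-2) on an arc of length 1 - r
   of the circle of radius r.  On the unit circle the inverse of phi is
   z |-> (z + x) / (1 + x z) with x = Re z, which is Lipschitz. *)

Require Import Defs.
From HB Require Import structures.
From mathcomp Require Import all_boot all_order all_algebra.
From mathcomp Require Import all_classical all_reals all_analysis.
From mathcomp.real_closed Require Import complex.
From mathcomp Require Import measurable_realfun ring lra.
Set Implicit Arguments.
Unset Strict Implicit.
Unset Printing Implicit Defensive.
Import Order.TTheory GRing.Theory Num.Theory numFieldNormedType.Exports.
Import Normc.
Local Open Scope classical_set_scope.
Local Open Scope complex_scope.
Local Open Scope ring_scope.

(** * Topology of the complex plane *)

(** A Lipschitz inverse still lets phi expand boundary arcs: an arc of length d ending at 1 goes to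
    one of length of order d^(1/3). This lowers the order 2 of the pole of g to 2/3, below the
    threshold 1 for integrability on the circle. The exponent 1/3 is convenient because it makes Q a
    polynomial in the real coordinates, so that the boundary inverse is a rational expression in z
    and x. Two obstacles shape the proof. Quasiregularity is stated through weak derivatives and an
    almost everywhere inequality; since W omits 0 in the disc, where P fails to be smooth, all maps
    involved are C^1 there, and Wirtinger derivatives computed along curves suffice. Moreover W is
    infinite at z = 1, so on the closed disc the pair 1 + z, 1 - z serves as homogeneous coordinates
    in place of their quotient, which the multiplicativity of P and Q permits. *)

Lemma cnormE (R : realType) (z : R[i]^o) : `|z| = (normc z)%:C.
Proof. by []. Qed.

Lemma normc_ge0 (R : realType) (z : R[i]) : 0 <= normc z.
Proof. by case: z => a b; exact: sqrtr_ge0. Qed.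

Lemma normc_sqr (R : realType) (z : R[i]) :
  normc z ^+ 2 = complex.Re z ^+ 2 + complex.Im z ^+ 2.
Proof. by case: z => a b /=; rewrite sqr_sqrtr// addr_ge0 ?sqr_ge0. Qed.

Lemma Re_le_normc (R : realType) (z : R[i]) : `|complex.Re z| <= normc z.
Proof.
rewrite -(ler_pXn2r (n := 2)) ?nnegrE ?normc_ge0// normc_sqr real_normK
  ?num_real//.
by rewrite lerDl sqr_ge0.
Qed.

Lemma Im_le_normc (R : realType) (z : R[i]) : `|complex.Im z| <= normc z.
Proof.
rewrite -(ler_pXn2r (n := 2)) ?nnegrE ?normc_ge0// normc_sqr real_normK
  ?num_real//.
by rewrite lerDr sqr_ge0.
Qed.

Lemma normc_le (R : realType) (z : R[i]) :
  normc z <= `|complex.Re z| + `|complex.Im z|.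
Proof.
rewrite -(ler_pXn2r (n := 2)) ?nnegrE ?normc_ge0 ?addr_ge0// normc_sqr.
rewrite -(real_normK (num_real (complex.Re z))) -(real_normK (num_real
  (complex.Im z))).
have := normr_ge0 (complex.Re z); have := normr_ge0 (complex.Im z).
nra.
Qed.

Lemma ReB (R : realType) (z w : R[i]) :
  complex.Re (z - w) = complex.Re z - complex.Re w.
Proof. by case: z; case: w. Qed.

Lemma ImB (R : realType) (z w : R[i]) :
  complex.Im (z - w) = complex.Im z - complex.Im w.
Proof. by case: z; case: w. Qed.

Lemma near_normc (R : realType) (z : R[i]^o) (e : R) :
  0 < e -> \forall w \near z, normc (z - w) < e.
Proof.
move=> e0; have e0' : 0 < e%:C by rewrite ltcR.
have H := @cvgr_dist_lt _ R[i]^o _ (nbhs z) _ id z cvg_id _ e0'.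
by near=> w; rewrite -ltcR; near: w; exact: H.
Unshelve. all: by end_near. Qed.

Lemma Re_continuous (R : realType) :
  continuous (fun z : R[i]^o => complex.Re z).
Proof.
move=> z; apply/(@cvgrPdist_lt _ _ _ (nbhs z)) => e e0.
near=> w; apply: (@le_lt_trans _ _ (normc (z - w))).
  by rewrite -ReB; exact: Re_le_normc.
by near: w; exact: near_normc.
Unshelve. all: by end_near. Qed.

Lemma Im_continuous (R : realType) :
  continuous (fun z : R[i]^o => complex.Im z).
Proof.
move=> z; apply/(@cvgrPdist_lt _ _ _ (nbhs z)) => e e0.
near=> w; apply: (@le_lt_trans _ _ (normc (z - w))).
  by rewrite -ImB; exact: Im_le_normc.
by near: w; exact: near_normc.
Unshelve. all: by end_near. Qed.

Lemma cvg_complex (R : realType) (T : Type) (F : set_system T) {FF : Filter F}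
    (f : T -> R[i]^o) (z : R[i]^o) :
  complex.Re (f x) @[x --> F] --> complex.Re z ->
  complex.Im (f x) @[x --> F] --> complex.Im z ->
  f x @[x --> F] --> z.
Proof.
move=> /cvgrPdist_lt fRe /cvgrPdist_lt fIm; apply/cvgrPdist_lt => e e0.
(* In the order of [R[i]], [0 < e] forces e to be real, so the estimate can be made in R. *)
move: e0; rewrite ltcE => /andP[/= /eqP ie re].
have -> : e = (complex.Re e)%:C by case: e ie {re} => a b /= ->.
have re2 : 0 < complex.Re e / 2 by rewrite divr_gt0.
near=> x.
rewrite cnormE ltcR; apply: le_lt_trans (normc_le _) _.
rewrite ReB ImB (splitr (complex.Re e)).
apply: ltrD; near: x; [exact: fRe|exact: fIm].
Unshelve. all: by end_near. Qed.

Lemma complex_of_continuous (R : realType) : continuous (@complex_of R).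
Proof. by move=> p; apply: cvg_complex => /=;
  [exact: cvg_fst|exact: cvg_snd]. Qed.

(** * Measurability and integrability in the plane *)

(** Each point of an open set lies in a rectangle with rational corners inside the set, and there
    are countably many of these. This links the topology of the plane to the product sigma-algebra
    used by [area]. *)
Lemma open_measurable_plane (R : realType) (A : set (R * R)) : open A ->
  measurable (A : set (measurableTypeR R * measurableTypeR R)).
Proof.
move=> oA.
pose rect (q : (rat * rat) * (rat * rat)) : set (R * R) :=
  `]ratr q.1.1, ratr q.1.2[%classic `*` `]ratr q.2.1, ratr q.2.2[%classic.
have -> : A = \bigcup_q (if `[< rect q `<=` A >] then rect q else set0).
  apply/seteqP; split => [p Ap|p [q _]]; last first.
    by case: ifPn => // /asboolP; exact.
  have [e /= e0 eA] : nbhs_ball p A by apply/nbhs_ballP; exact: open_nbhs_nbhs.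
  have mid x : exists q : rat * rat,
      (x - e < ratr q.1 < x) && (x < ratr q.2 < x + e).
    have /rat_in_itvoo[a /[!in_itv]/= xa] : x - e < x by rewrite ltrBlDr ltrDl.
    have /rat_in_itvoo[b /[!in_itv]/= xb] : x < x + e by rewrite ltrDl.
    by exists (a, b); rewrite xa xb.
  have [q1 /andP[/andP[a1 b1] /andP[c1 d1]]] := mid p.1.
  have [q2 /andP[/andP[a2 b2] /andP[c2 d2]]] := mid p.2.
  exists (q1, q2) => //; case: ifPn => [_|/asboolP[] r].
    by split; rewrite /= in_itv/= ?b1 ?b2.
  rewrite /rect/= => -[]; rewrite !in_itv/= => /andP[r1 r1'] /andP[r2 r2'].
  by apply: eA; split; rewrite /ball/= /ball_/= ltr_norml; lra.
apply: countable_bigcupT_measurable => [|q]; first exact: countableP.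
by case: ifPn => // _; apply: measurableX; exact: measurable_itv.
Qed.

Lemma continuous_measurable_plane (R : realType) (D : set (R * R))
    (u : R * R -> R) : open D -> {in D, continuous u} ->
  @measurable_fun _ _ (measurableTypeR R * measurableTypeR R)%type R D u.
Proof.
move=> oD; rewrite -(continuous_open_subspace u oD) => /continuousP cu mD.
apply: (measurability _ (measurable_realfun.RGenOpens.measurableE R)).
move=> _ [_ [a [b ->] <-]].
have /open_subspaceP[V oV VD] : open (u @^-1` `]a, b[%classic :
  set (subspace D)).
  exact/cu/interval_open.
rewrite setIC -VD; apply: measurableI; last exact: mD.
exact: open_measurable_plane.
exact: mD.
Qed.

Lemma compact_measurable_plane (R : realType) (K : set (R * R)) : compact K ->
  measurable (K : set (measurableTypeR R * measurableTypeR R)).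
Proof.
move=> cpK.
have cK := compact_closed (@norm_hausdorff _ (R * R)%type) cpK.
rewrite -(setCK K); apply: measurableC; apply: open_measurable_plane.
exact: closed_openC.
Qed.

Lemma disc_open (R : realType) : open (disc R).
Proof.
move=> p; rewrite /interior /= /disc /unit_disc /= => p1.
have p0 : 0 < 1 - normc (complex_of p) by rewrite subr_gt0.
near=> q.
change (normc (complex_of q) < 1).
have -> : complex_of q = complex_of p - (complex_of p - complex_of q).
  by rewrite opprB addrC subrK.
apply: le_lt_trans (le_normcD _ _) _; rewrite normcN -ltrBrDl.
near: q.
exact: (@complex_of_continuous R p _ (near_normc (complex_of p) p0)).
Unshelve. all: by end_near. Qed.

Lemma disc_measurable (R : realType) :
  measurable (disc R : set (measurableTypeR R * measurableTypeR R)).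
Proof. exact: open_measurable_plane (@disc_open R). Qed.

Lemma discE (R : realType) (p : R * R) :
  disc R p = (p.1 ^+ 2 + p.2 ^+ 2 < 1) :> Prop.
Proof.
rewrite /disc /unit_disc/= /complex_of -(ltr_pXn2r (n :=
  2)) ?nnegrE ?sqrtr_ge0//.
by rewrite expr1n sqr_sqrtr// addr_ge0 ?sqr_ge0.
Qed.

Lemma area_disc_fin (R : realType) : (area R (disc R) < +oo)%E.
Proof.
have mI : measurable (`[-1, 1]%classic : set (measurableTypeR R)).
  exact: measurable_itv.
apply: (@le_lt_trans _ _ (area R (`[-1, 1]%classic `*` `[-1, 1]%classic))).
  apply: le_measure; rewrite ?inE; [exact: disc_measurable|exact: measurableX|].
  by move=> p; rewrite discE => p1; split; rewrite /= in_itv/=; nra.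
have I2 : @lebesgue_measure R `[-1, 1]%classic = 2%:E.
  rewrite lebesgue_measure_itv/= lte_fin ifT; last lra.
  by rewrite -EFinD opprK.
rewrite /area product_measure1E//.
by rewrite [X in (X * _)%E]I2 [X in (_ * X)%E]I2 -EFinM ltry.
Qed.

(** A function continuous in the open disc may blow up at the circle; here f is bounded on the
    compact K, zero off it, and the disc has finite area. It serves products with test functions. *)
Lemma supported_integrable (R : realType) (f : R * R -> R) (K : set (R * R)) :
  {in disc R, continuous f} -> compact K -> K `<=` disc R ->
  (forall p, ~ K p -> f p = 0) ->
  (area R).-integrable (disc R) (EFin \o f).
Proof.
move=> cf cK KD f0.
apply: measurable_bounded_integrable.
- exact: disc_measurable.
- exact: area_disc_fin.
- by apply: continuous_measurable_plane => //; exact: disc_open.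
have /compact_bounded[M [Mr MK]] : compact (f @` K).
  apply: continuous_compact => //; apply: continuous_in_subspaceT => p pK.
  by apply: cf; rewrite inE; apply: KD; rewrite inE in pK.
exists (Num.max M 0); split => [|r]; first by rewrite num_real.
rewrite gt_max => /andP[Mx r0] p _ /=.
have [Kp|/f0 ->] := pselect (K p); first by apply: MK => //; exists p.
by rewrite normr0 ltW.
Qed.

(** * Weak derivatives of C^1 functions *)

Lemma integral_compact_primitive (R : realType) (F G : R -> R) :
  continuous G -> (forall t : R, is_derive t 1 F (G t)) ->
  (forall t, 1 < `|t| -> F t = 0) ->
  (forall t, 1 < `|t| -> G t = 0) ->
  (\int[@lebesgue_measure R]_t (G t)%:E = 0)%E.
Proof.
move=> cG dF F0 G0.
have cF : continuous F.
  move=> t; apply: differentiable_continuous; apply/derivable1_diffP.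
  by have [] := dF t.
(* The interval exceeds [-1, 1] so that the endpoints satisfy [1 < |t|], where F is known to
   vanish. *)
have -> : (fun t => (G t)%:E) = (EFin \o G) \_ `[-2, 2].
  apply/funext => t; rewrite patchE; case: ifPn => //= /negP t2.
  rewrite G0//; case: (ltP 1 `|t|) => // t1; exfalso; apply: t2.
  by rewrite inE/= in_itv/=; move: t1; rewrite ler_norml => /andP[]; lra.
rewrite -integral_mkcond (@continuous_FTC2 _ G F); first last.
- by move=> t _; rewrite derive1E; exact: derive_val.
- split => [t _| |]; first exact: ex_derive.
    apply: cvg_at_right_filter; exact: cF.
  apply: cvg_at_left_filter; exact: cF.
- exact: continuous_subspaceT.
- lra.
by rewrite !F0 ?subee//; rewrite ?normrN ger0_norm; lra.
Qed.

Lemma is_derive_slice (R : realType) (j : 'I_2) (v : R * R -> R) (p : R * R) d :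
  is_derive p (basis_vector R j) v d ->
  if j == 0 then is_derive p.1 1 (fun t => v (t, p.2)) d
  else is_derive p.2 1 (fun t => v (p.1, t)) d.
Proof.
case: p => x y [dv vE]; rewrite /basis_vector in dv vE.
have Z (h a b : R) :
    h *: ((a, b) : R * R) + (x, y) = (h *: a + x, h *: b + y) by [].
case: ifPn dv vE => _ /= dv vE.
- have E : (fun h : R => h^-1 *:
      (((fun t => v (t, y)) \o shift x) (h *: 1) - v (x, y))) =
    (fun h => h^-1 *: ((v \o shift (x, y)) (h *: (1, 0)) - v (x, y))).
    by apply/funext => h /=; rewrite Z scaler0 add0r.
  by split; rewrite /derivable /derive E.
- have E : (fun h : R => h^-1 *:
      (((fun t => v (x, t)) \o shift y) (h *: 1) - v (x, y))) =
    (fun h => h^-1 *: ((v \o shift (x, y)) (h *: (0, 1)) - v (x, y))).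
    by apply/funext => h /=; rewrite Z scaler0 add0r.
  by split; rewrite /derivable /derive E.
Qed.


(** Fubini, with the inner integral taken in the direction of differentiation: on every line it is
    the integral of the derivative of a function of bounded support, hence zero. *)
Lemma integral_derive_compact (R : realType) (j : 'I_2) (v w : R * R -> R) :
  continuous w ->
  (forall p, is_derive p (basis_vector R j) v (w p)) ->
  (forall p, ~ disc R p -> v p = 0) -> (forall p, ~ disc R p -> w p = 0) ->
  (area R).-integrable setT (EFin \o w) ->
  (\int[area R]_p (w p)%:E = 0)%E.
Proof.
move=> cw dv v0 w0 iw.
have out (x y : R) : (1 < `|x|) || (1 < `|y|) -> ~ disc R (x, y).
  rewrite discE /= -(real_normK (num_real x)) -(real_normK (num_real y)).
  by have := normr_ge0 x; have := normr_ge0 y => ? ? /orP[]; nra.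
have cx y : continuous (fun x => w (x, y)).
  move=> x; apply: (@continuous_comp _ _ _ (fun x => (x, y)) w x _ (cw (x, y))).
  apply: (@cvg_pair _ _ _ (nbhs x) (nbhs x) (nbhs y) _ _ _ id (fun=> y)).
    exact: cvg_id.
  exact: cvg_cst.
have cy x : continuous (fun y => w (x, y)).
  move=> y; apply: (@continuous_comp _ _ _ (fun y => (x, y)) w y _ (cw (x, y))).
  apply: (@cvg_pair _ _ _ (nbhs y) (nbhs x) (nbhs y) _ _ _ (fun=> x) id).
    exact: cvg_cst.
  exact: cvg_id.
have [j0|j0] := eqVneq j 0.
  rewrite -(integral21_prod_meas1 iw) /fubini_G.
  apply: integral0_eq => y _.
  apply: (@integral_compact_primitive _ (fun x => v (x, y)) (fun x => w (x,
    y))).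
  - exact: cx.
  - by move=> x; have := is_derive_slice (dv (x, y)); rewrite j0.
  - by move=> x x1; apply/v0/out; rewrite x1.
  - by move=> x x1; apply/w0/out; rewrite x1.
rewrite -(integral12_prod_meas1 iw) /fubini_F.
apply: integral0_eq => x _.
apply: (@integral_compact_primitive _ (fun y => v (x, y)) (fun y => w (x, y))).
- exact: cy.
- by move=> y; have := is_derive_slice (dv (x, y)); rewrite (negbTE j0).
- by move=> y y1; apply/v0/out; rewrite y1 orbT.
- by move=> y y1; apply/w0/out; rewrite y1 orbT.
Qed.

(* The product of [u] and a test function, extended by zero, is C^1 with compact
   support, so its partial derivatives have integral zero. *)
Lemma weak_partial_C1 (R : realType) (j : 'I_2) (u w : R * R -> R) :
  {in disc R, continuous u} -> {in disc R, continuous w} ->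
  (forall p, disc R p -> is_derive p (basis_vector R j) u (w p)) ->
  weak_partial j u w.
Proof.
move=> cu cw du h [Ch cpt suppD]; set supp := closure _ in cpt suppD.
set e := basis_vector R j in du *.
have [ch Ch0] := Ch 1%N.
have [dh [cDh _]] := Ch0 j; rewrite -/e in dh cDh.
have oD := @disc_open R.
have off p : ~ supp p -> \forall q \near p, h q = 0.
  move=> np; have : nbhs p (~` supp).
    apply: open_nbhs_nbhs; split => //; apply: closed_openC.
    exact: closed_closure.
  apply: filterS => q nq; apply/eqP/negPn/negP => hq; apply: nq.
  exact: subset_closure.
have off0 p : ~ supp p -> h p = 0 by move=> /off/nbhs_singleton.
have offD p : ~ supp p -> 'D_e h p = 0.
  by move=> /off/(near_eq_derive e) ->; exact: derive_cst.
(* [near_join] makes h vanish around each q close to p, not only at q, and so kills the derivative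
   at q. *)
have off2 p : ~ supp p -> \forall q \near p, h q = 0 /\ 'D_e h q = 0.
  move=> /off/near_join; apply: filterS => q hq; split.
    exact: nbhs_singleton hq.
  by rewrite (near_eq_derive e hq) derive_cst.
have suppP p : ~ disc R p -> ~ supp p by move=> np /suppD.
have near_disc p : disc R p -> \forall q \near p, disc R q.
  by move=> Dp; apply: open_nbhs_nbhs.
pose v0 := (fun p => u p * h p) \_ (disc R).
pose d1 := fun p => u p * 'D_e h p.
pose d2 := fun p => w p * h p.
pose w0 := (fun p => d1 p + d2 p) \_ (disc R).
have cd1 : {in disc R, continuous d1}.
  by move=> p pD; exact: (cvgM (cu p pD) (cDh p)).
have cd2 : {in disc R, continuous d2}.
  by move=> p pD; exact: (cvgM (cw p pD) (ch p)).
have i1 : (area R).-integrable (disc R) (EFin \o d1).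
  by apply: supported_integrable cd1 cpt suppD _ => p /offD; rewrite /d1 => ->;
    rewrite mulr0.
have i2 : (area R).-integrable (disc R) (EFin \o d2).
  by apply: supported_integrable cd2 cpt suppD _ => p /off0; rewrite /d2 => ->;
    rewrite mulr0.
have mD := @disc_measurable R.
have w0E : EFin \o w0 = (fun p => (d1 p)%:E + (d2 p)%:E)%E \_ (disc R).
  by apply/funext => p /=; rewrite /w0 !patchE; case: ifP.
have I0 : (\int[area R]_p (w0 p)%:E = 0)%E.
  apply: (@integral_derive_compact _ j v0).
  (* Near a point of the disc, [w0] agrees with a continuous function; any other point lies off the
     closed set [supp], and [w0] vanishes near it. *)
  - move=> p; have [Dp|/suppP np] := pselect (disc R p).
      apply: (@cvg_trans _ ((d1 q + d2 q) @[q --> p])).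
        apply: near_eq_cvg; move: (near_disc _ Dp); apply: filterS => q Dq.
        by rewrite /w0 patchE mem_set.
      rewrite /w0 patchE mem_set//.
      have pD : p \in disc R by rewrite inE.
      exact: (cvgD (cd1 p pD) (cd2 p pD)).
    have w00 q : h q = 0 /\ 'D_e h q = 0 -> w0 q = 0.
      by rewrite /w0 patchE /d1 /d2 => -[-> ->]; case: ifP;
        rewrite ?mulr0 ?addr0.
    rewrite /continuous_at (w00 p); last exact: nbhs_singleton (off2 _ np).
    apply: cvg_near_cst; move: (off2 _ np); by apply: filterS => q /w00.
  - move=> p; rewrite -/e; have [Dp|np] := pselect (disc R p).
      apply: (@near_eq_is_derive _ _ _ (fun q => u q * h q)).
        move: (near_disc _ Dp); apply: filterS => q Dq.
        by rewrite /v0 patchE mem_set.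
      have dup := du _ Dp; have dhp := derivableP (dh p).
      have := is_deriveM dup dhp.
      by rewrite /w0 patchE mem_set// /d1 /d2 /GRing.scale/= [h p * _]mulrC.
    rewrite /w0 patchE memNset//.
    apply: (@near_eq_is_derive _ _ _ (cst 0)).
      move: (off _ (suppP _ np)); apply: filterS => q hq.
      by rewrite /v0 patchE hq mulr0; case: ifP.
  - by move=> p np; rewrite /v0 patchE memNset.
  - by move=> p np; rewrite /w0 patchE memNset.
  - by rewrite w0E; apply: (integrable_mkcond _ mD).1 (integrableD mD i1 i2).
apply/eqP; rewrite -addr_eq0 -(RintegralD mD i1 i2); apply/eqP.
rewrite /Rintegral -[RHS]/(fine 0%E) -I0 [in LHS]integral_mkcond; congr fine.
by rewrite -[in RHS]/(EFin \o w0) w0E.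
Qed.

(** * Quasiregularity of C^1 mappings *)

Lemma L2loc_continuous (R : realType) (u : R * R -> R) :
  {in disc R, continuous u} -> L2loc u.
Proof.
move=> cu.
have cu2 : {in disc R, continuous (fun p => u p ^+ 2)}.
  by move=> p pD; exact: (cvgM (cu p pD) (cu p pD)).
have mu : @measurable_fun _ _ (measurableTypeR R * measurableTypeR R)%type R
    (disc R) u.
  by apply: continuous_measurable_plane => //; exact: disc_open.
split=> // K cK KD; have mK := compact_measurable_plane cK.
suff : (area R).-integrable K (EFin \o (fun p => u p ^+ 2)).
  exact: integrable_lty.
apply: measurable_bounded_integrable => //.
- apply: le_lt_trans (area_disc_fin R); apply: le_measure; rewrite ?inE//.
  exact: disc_measurable.
- apply: (@measurable_funS _ _ _ _ (disc R)) => //;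
  first exact: disc_measurable.
  by apply: continuous_measurable_plane cu2; exact: disc_open.
have /compact_bounded : compact ((fun p => u p ^+ 2) @` K).
  apply: continuous_compact => //; apply: continuous_in_subspaceT => p pK.
  by apply: cu2; rewrite inE in pK; rewrite inE; exact: KD.
by move=> [M [Mr MK]]; exists M; split => // r Mr' p Kp; apply: MK => //;
  exists p.
Qed.

Definition curve_derive (R : realType) (c : R -> R[i]) (t : R) (d : R[i]) :=
  is_derive t (1 : R) (fun s => complex.Re (c s)) (complex.Re d) /\
  is_derive t (1 : R) (fun s => complex.Im (c s)) (complex.Im d).

(* [p] and [q] are the derivatives of [f] at [z] with respect to z and its
   conjugate.  Testing along curves makes the chain rule an application. *)
Definition wirtinger (R : realType) (f : R[i] -> R[i]) (z p q : R[i]) :=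
  forall c t e, c t = z -> curve_derive c t e ->
    curve_derive (f \o c) t (p * e + q * e^*%C).

Lemma component_continuous (R : realType) (f : R[i]^o -> R[i]^o) (i : 'I_2) :
  {in unit_disc R, continuous f} -> {in disc R, continuous (component f i)}.
Proof.
move=> cf p; rewrite inE => pD.
have cfp : {for p, continuous (f \o @complex_of R)}.
  apply: continuous_comp; first exact: complex_of_continuous.
  by apply: cf; rewrite inE.
rewrite /component; case: (i == 0).
  exact: (continuous_comp cfp (@Re_continuous R _)).
exact: (continuous_comp cfp (@Im_continuous R _)).
Qed.

Lemma is_derive_affine (R : realType) (a b t : R) :
  is_derive t (1 : R) (fun s => s * b + a) b.
Proof.
have H : is_derive t (1 : R) (id * cst b + cst a : R -> R) b.
  by apply: is_derive_eq; rewrite /GRing.scale/= mulr0 mulr1 add0r addr0.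
exact: H.
Qed.

(** The curve to test on is the straight line through p along a basis vector. The [component] of a
    constant map in the conclusion merely selects the real or imaginary part. *)
Lemma component_is_derive (R : realType) (f : R[i]^o -> R[i]^o) (i j : 'I_2)
    (p : R * R) (a b : R[i]) :
  wirtinger f (complex_of p) a b ->
  is_derive p (basis_vector R j) (component f i)
    (component (fun=> let e := complex_of (basis_vector R j) in a * e + b *
      e^*%C)
       i p).
Proof.
move=> fab; set e := basis_vector R j.
pose c (s : R) := complex_of (s *: e + p).
have c0 : c 0 = complex_of p by rewrite /c scale0r add0r.
have dc : curve_derive c 0 (complex_of e).
  by split; exact: is_derive_affine.
have := fab c 0 (complex_of e) c0 dc; set d := a * _ + _ => -[dRe dIm].
have slice (g : R[i] -> R) d' : is_derive 0 (1 : R) (fun s => g (f (c s))) d' ->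
    is_derive p e (fun r => g (f (complex_of r))) d'.
  have E : (fun h : R => h^-1 *: (((fun s => g (f (c s))) \o shift 0) (h *: 1)
        - g (f (c 0)))) =
      (fun h : R => h^-1 *: (((fun r => g (f (complex_of r))) \o shift p) (h *:
        e)
        - g (f (complex_of p)))).
    by apply/funext => h; rewrite c0 /= addr0 /GRing.scale/= mulr1.
  move=> [+ <-]; rewrite /derivable /derive E => dg.
  by split; rewrite /derivable /derive.
by rewrite /component; case: (i == 0); apply: slice.
Qed.

Lemma euclidean_norm_complex (R : realType) (v : 'cV[R]_2) :
  euclidean_norm v = normc (v 0 0 +i* v 1 0).
Proof.
rewrite /euclidean_norm !big_ord_recl big_ord0 addr0 /=.
by rewrite (_ : lift ord0 ord0 = 1)//; exact: val_inj.
Qed.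

Lemma operator_norm_sqr_le (R : realType) (A : 'M[R]_2) (b : R) :
  (forall v, euclidean_norm (A *m v) <= b * euclidean_norm v) ->
  operator_norm A ^+ 2 <= b ^+ 2.
Proof.
rewrite /operator_norm => Ab; set S := (X in sup X).
have n0 : euclidean_norm (0 : 'cV[R]_2) = 0.
  by rewrite euclidean_norm_complex !mxE; exact: normc0.
have S0 : S 0 by exists 0; rewrite /= ?mulmx0 n0.
(* Testing on a unit vector gives the sign needed for squaring. *)
have b0 : 0 <= b.
  have := Ab (delta_mx 0 0).
  have -> : euclidean_norm (delta_mx 0 0 : 'cV[R]_2) = 1.
    by rewrite euclidean_norm_complex !mxE/= expr1n expr0n addr0 sqrtr1.
  by rewrite mulr1; apply: le_trans; exact: sqrtr_ge0.
have Sb : ubound S b.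
  by move=> _ [v /= v1 <-]; apply: le_trans (Ab v) _; rewrite ler_piMr.
have op0 : 0 <= sup S by apply: ub_le_sup S0; exists b.
rewrite ler_pXn2r ?nnegrE//; apply: ge_sup => //; by exists 0.
Qed.

(** In complex notation the differential is w -> p w + q w^*, so its operator norm is at most |p| +
    |q| and its determinant is |p|^2 - |q|^2. Continuity of p and q makes the classical partial
    derivatives weak ones in L^2_loc. *)
Lemma wirtinger_quasiregular (R : realType) (K : R) (f p q : R[i]^o -> R[i]^o) :
  {in unit_disc R, continuous f} -> {in unit_disc R, continuous p} ->
  {in unit_disc R, continuous q} ->
  (forall z, unit_disc R z -> wirtinger f z (p z) (q z)) ->
  (forall z, unit_disc R z ->
    (normc (p z) + normc (q z)) ^+ 2 <=
      K * (normc (p z) ^+ 2 - normc (q z) ^+ 2)) ->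
  K_quasiregular K f.
Proof.
move=> cf cp cq fpq pqK.
split; first exact: (@continuous_in_subspaceT _ _ _ f cf).
pose e j : R[i]^o := complex_of (basis_vector R j).
pose d j (z : R[i]^o) : R[i]^o := p z * e j + q z * (e j)^*%C.
have cd j : {in unit_disc R, continuous (d j)}.
  move=> z zD.
  exact: (cvgD (cvgM (cp z zD) (cvg_cst (e j))) (cvgM (cq z zD) (cvg_cst ((e
    j)^*%C : R[i]^o)))).
pose Df r : 'M[R]_2 := \matrix_(i, j) component (d j) i r.
exists Df.
  move=> i; split; first exact: (L2loc_continuous (@component_continuous _ _ i
    cf)).
  move=> j; have -> : (fun r => Df r i j) = component (d j) i.
    by apply/funext => r; rewrite mxE.
  have cdj := @component_continuous _ _ i (cd j).
  split; first exact: (L2loc_continuous cdj).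
  apply: (weak_partial_C1 (@component_continuous _ _ i cf) cdj).
  by move=> r rD; apply: component_is_derive; exact: fpq.
apply: aeW => r rD; set z := complex_of r.
have -> : \det (Df r) = normc (p z) ^+ 2 - normc (q z) ^+ 2.
  rewrite (expand_det_row _ 0) !big_ord_recl big_ord0 addr0.
  rewrite /cofactor !det_mx11 !mxE !normc_sqr /component/= /d /e
    /basis_vector/= -/z.
  case: (p z) => a b; case: (q z) => a' b' /=.
  ring.
apply: le_trans (operator_norm_sqr_le (b := normc (p z) + normc (q z)) _) _.
  move=> v; rewrite !euclidean_norm_complex.
  set w := v 0 0 +i* v 1 0.
  have -> : (Df r *m v) 0 0 +i* (Df r *m v) 1 0 = p z * w + q z * w^*%C.
    rewrite !mxE !big_ord_recl !big_ord0 !addr0 !mxE /component/= /d /e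
      /basis_vector/= -/z.
    rewrite (_ : lift ord0 ord0 = 1); last exact: val_inj.
    rewrite /w; case: (p z) => a b; case: (q z) => a' b'.
    apply/eqP; rewrite eq_complex /=; apply/andP; split; apply/eqP; ring.
  apply: le_trans (le_normcD _ _) _; rewrite !normcM mulrDl.
  by rewrite (_ : normc w^*%C = normc w)// /w /= sqrrN.
exact: pqK.
Qed.

(** * Wirtinger derivatives *)

Lemma curve_deriveP (R : realType) (c : R -> R[i]) (t : R) (d : R[i])
    (x y : R -> R)
    (x' y' : R) :
  c = (fun s => x s +i* y s) -> is_derive t (1 : R) x x' ->
  is_derive t (1 : R) y y' -> x' +i* y' = d -> curve_derive c t d.
Proof. by move=> -> ? ? <-; split. Qed.

Lemma curve_derive_cst (R : realType) (a : R[i]) (t : R) :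
  curve_derive (fun=> a) t 0.
Proof. by split; exact: is_derive_cst. Qed.

Lemma curve_deriveD (R : realType) (c1 c2 : R -> R[i]) (t : R) (d1 d2 : R[i]) :
  curve_derive c1 t d1 -> curve_derive c2 t d2 ->
  curve_derive (fun s => c1 s + c2 s) t (d1 + d2).
Proof.
move=> [x1 y1] [x2 y2]; apply: (curve_deriveP _ (is_deriveD x1 x2) (is_deriveD
  y1 y2)).
  by apply/funext => s; rewrite !fctE; case: (c1 s); case: (c2 s).
by case: d1 x1 y1; case: d2 x2 y2.
Qed.

Lemma curve_deriveM (R : realType) (c1 c2 : R -> R[i]) (t : R) (d1 d2 : R[i]) :
  curve_derive c1 t d1 -> curve_derive c2 t d2 ->
  curve_derive (fun s => c1 s * c2 s) t (d1 * c2 t + c1 t * d2).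
Proof.
move=> [x1 y1] [x2 y2].
apply: (curve_deriveP _ (is_deriveB (is_deriveM x1 x2) (is_deriveM y1 y2))
  (is_deriveD (is_deriveM x1 y2) (is_deriveM y1 x2))).
  by apply/funext => s; rewrite !fctE; case: (c1 s); case: (c2 s).
case: d1 x1 y1 => a1 b1 _ _; case: d2 x2 y2 => a2 b2 _ _.
case: (c1 t) => p1 q1; case: (c2 t) => p2 q2.
by apply/eqP; rewrite eq_complex /= /GRing.scale/=; apply/andP; split;
  apply/eqP; ring.
Qed.

Lemma curve_deriveB (R : realType) (c1 c2 : R -> R[i]) (t : R) (d1 d2 : R[i]) :
  curve_derive c1 t d1 -> curve_derive c2 t d2 ->
  curve_derive (fun s => c1 s - c2 s) t (d1 - d2).
Proof.
move=> [x1 y1] [x2 y2]; apply: (curve_deriveP _ (is_deriveB x1 x2) (is_deriveB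
  y1 y2)).
  by apply/funext => s; rewrite !fctE; case: (c1 s); case: (c2 s).
by case: d1 x1 y1; case: d2 x2 y2.
Qed.

Lemma curve_derive_real (R : realType) (x : R -> R) (t d : R) :
  is_derive t (1 : R) x d -> curve_derive (fun s => (x s)%:C) t d%:C.
Proof. by move=> dx; split => //=; exact: is_derive_cst. Qed.

Lemma curve_derive_conj (R : realType) (c : R -> R[i]) (t : R) (d : R[i]) :
  curve_derive c t d -> curve_derive (fun s => (c s)^*%C) t d^*%C.
Proof.
move=> [dx dy]; apply: (curve_deriveP _ dx (is_deriveN dy)).
  by apply/funext => s; rewrite !fctE; case: (c s).
by case: d dx dy.
Qed.

Lemma normc_sqrJ (R : realType) (z : R[i]) : (normc z ^+ 2)%:C = z * z^*%C.
Proof.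
case: z => a b; rewrite normc_sqr; apply/eqP; rewrite eq_complex /=.
by apply/andP; split; apply/eqP; ring.
Qed.

Lemma is_derive_normc_sqr (R : realType) (c : R -> R[i]) (t : R) (d : R[i]) :
  curve_derive c t d ->
  is_derive t (1 : R) (fun s => normc (c s) ^+ 2)
    (2 * complex.Re (d * (c t)^*%C)).
Proof.
move=> dc; have [H _] := curve_deriveM dc (curve_derive_conj dc).
have -> : (fun s => normc (c s) ^+ 2) = (fun s => complex.Re (c s * (c s)^*%C)).
  by apply/funext => s; rewrite -normc_sqrJ.
apply: is_derive_eq H _.
by case: (d) (c t) => a b [a' b'] /=; ring.
Qed.

Lemma curve_derive_eq (R : realType) (c : R -> R[i]) (t : R) (d d' : R[i]) :
  curve_derive c t d -> d = d' -> curve_derive c t d'.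
Proof. by move=> + <-. Qed.

Lemma normc_gt0 (R : realType) (z : R[i]) : z != 0 -> 0 < normc z.
Proof.
move=> z0; rewrite lt0r normc_ge0 andbT; apply: contra z0 => /eqP z0.
by apply/eqP; exact: eq0_normc.
Qed.

Lemma double_Re (R : realType) (z : R[i]) : (2 * complex.Re z)%:C = z + z^*%C.
Proof.
by case: z => a b; apply/eqP; rewrite eq_complex /=; apply/andP; split;
  apply/eqP; ring.
Qed.

Lemma conjM (R : realType) (z w : R[i]) : (z * w)^*%C = z^*%C * w^*%C.
Proof. exact: rmorphM. Qed.

Lemma conj_neq0 (R : realType) (z : R[i]) : z != 0 -> z^*%C != 0.
Proof. by rewrite conjc_eq0. Qed.

Lemma invE (R : realType) (z : R[i]) : z^-1 = (normc z ^+ 2)^-1%:C * z^*%C.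
Proof.
have [->|z0] := eqVneq z 0; first by rewrite invr0 conjc0 mulr0.
by rewrite fmorphV/= normc_sqrJ; field; rewrite z0 conj_neq0.
Qed.

(** Writing 1 / c = c^* / |c|^2 reduces the complex quotient rule to the product rule and the
    inverse of a real function. *)
Lemma curve_deriveV (R : realType) (c : R -> R[i]) (t : R) (d : R[i]) :
  c t != 0 -> curve_derive c t d ->
  curve_derive (fun s => (c s)^-1) t (- d / c t ^+ 2).
Proof.
move=> ct0 dc; have ctJ := conj_neq0 ct0.
have n0 : normc (c t) ^+ 2 != 0 by rewrite expf_neq0// gt_eqF// normc_gt0.
have := @is_deriveV _ (fun s => normc (c s) ^+ 2) _ _ _ n0 (is_derive_normc_sqr
  dc) => /curve_derive_real dn.
have := curve_deriveM dn (curve_derive_conj dc).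
have -> : (fun s => ((normc (c s) ^+ 2)^-1)%:C * (c s)^*%C) = (fun s => (c
  s)^-1).
  by apply/funext => s; rewrite -invE.
move/curve_derive_eq; apply.
rewrite /GRing.scale/= rmorphM rmorphN !fmorphV/= rmorphXn/= double_Re
  !normc_sqrJ.
rewrite conjM conjcK; field.
by rewrite ct0 ctJ.
Qed.

(* [cbrt_inv 0 = 0], so that [radial_cbrt] below, i.e. u |u|^(-2/3), is
   continuous at the origin. *)
Definition cbrt_inv (R : realType) (x : R) : R := x `^ (- 3^-1).

Lemma cbrt_inv_gt0 (R : realType) (x : R) : 0 < x -> 0 < cbrt_inv x.
Proof. exact: powR_gt0. Qed.

Lemma cbrt_invM (R : realType) (x y : R) : 0 <= x -> 0 <= y ->
  cbrt_inv (x * y) = cbrt_inv x * cbrt_inv y.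
Proof. exact: powRM. Qed.

Lemma cbrt_invX3 (R : realType) (x : R) : 0 <= x -> cbrt_inv (x ^+ 3) = x^-1.
Proof.
move=> x0; rewrite /cbrt_inv -powR_mulrn// -powRrM mulrN mulfV ?powR_inv1//.
Qed.

Lemma cbrt_invK (R : realType) (x : R) : 0 <= x -> cbrt_inv x ^+ 3 = x^-1.
Proof.
by move=> x0; rewrite -cbrt_invX3// exprS expr2 !cbrt_invM ?mulr_ge0//.
Qed.

Lemma is_derive_cbrt_inv (R : realType) (x : R) : 0 < x ->
  is_derive x (1 : R) (@cbrt_inv R) (- 3^-1 * (cbrt_inv x / x)).
Proof.
move=> x0; apply: (is_derive_eq (is_derive1_powR (- 3^-1) x0)).
by rewrite powRB ?powRr1 ?ltW// (gt_eqF x0) implybT.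
Qed.

Definition radial_cbrt (R : realType) (u : R[i]^o) : R[i]^o :=
  (cbrt_inv (normc u ^+ 2))%:C * u.

Definition radial_cbrt_dz (R : realType) (u : R[i]^o) : R[i]^o :=
  (2 / 3 * cbrt_inv (normc u ^+ 2))%:C.

Definition radial_cbrt_dzbar (R : realType) (u : R[i]^o) : R[i]^o :=
  (- 3^-1 * cbrt_inv (normc u ^+ 2))%:C * (u / u^*%C).

(** Put l = |u|^(-2/3), a function of |u|^2 with derivative - l / (3 |u|^2). As d|u|^2 = u^* du + u
    du^*, the differential of l u has coefficient l - l / 3 at du and - (l / 3) u / u^* at du^*. *)
Lemma wirtinger_radial_cbrt (R : realType) (u : R[i]) : u != 0 ->
  wirtinger (@radial_cbrt R) u (radial_cbrt_dz u) (radial_cbrt_dzbar u).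
Proof.
move=> u0 c t d ctu dc; rewrite -ctu in u0 *.
have n0 : 0 < normc (c t) ^+ 2 by rewrite exprn_gt0// normc_gt0.
have := @is_derive1_comp _ _ (fun s => normc (c s) ^+ 2) _ _ _
  (is_derive_cbrt_inv n0) (is_derive_normc_sqr dc).
move=> /curve_derive_real/curve_deriveM/(_ dc)/curve_derive_eq; apply.
rewrite /radial_cbrt_dz /radial_cbrt_dzbar /=; set l := cbrt_inv _.
rewrite !rmorphM !fmorphV/= rmorphN fmorphV/= -/l -rmorphM/= double_Re.
rewrite normc_sqrJ conjM conjcK rmorph_nat; field.
by rewrite u0 andbT; exact: conj_neq0.
Qed.

Lemma wirtinger_comp (R : realType) (f g : R[i] -> R[i]) (z p q a : R[i]) :
  wirtinger f z p q -> wirtinger g (f z) a 0 ->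
  wirtinger (g \o f) z (a * p) (a * q).
Proof.
move=> wf wg c t e ctz dc.
have fct : (f \o c) t = f z by rewrite /= ctz.
have := wg _ _ _ fct (wf _ _ _ ctz dc) => /curve_derive_eq; apply.
by rewrite mul0r addr0 mulrDr !mulrA.
Qed.

Lemma wirtinger_comp_holo (R : realType) (f g : R[i] -> R[i]) (z a p q : R[i]) :
  wirtinger f z a 0 -> wirtinger g (f z) p q ->
  wirtinger (g \o f) z (p * a) (q * a^*%C).
Proof.
move=> wf wg c t e ctz dc.
have fct : (f \o c) t = f z by rewrite /= ctz.
have := wg _ _ _ fct (wf _ _ _ ctz dc) => /curve_derive_eq; apply.
by rewrite mul0r addr0 conjM !mulrA.
Qed.

(** * The Cayley transform and composition with analytic maps *)

Definition cayley (R : realType) (z : R[i]^o) : R[i]^o := (1 + z) / (1 - z).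

Definition cayley_inv (R : realType) (w : R[i]^o) : R[i]^o := (w - 1) / (w + 1).

Lemma wirtinger_cayley (R : realType) (z : R[i]) : 1 - z != 0 ->
  wirtinger (@cayley R) z (2 / (1 - z) ^+ 2) 0.
Proof.
move=> z1 c t e ctz dc; rewrite -ctz in z1 *.
have d1 := curve_derive_cst 1 t.
have := curve_deriveM (curve_deriveD d1 dc)
  (@curve_deriveV _ (fun s => 1 - c s) _ _ z1 (curve_deriveB d1 dc)).
move/curve_derive_eq; apply.
by rewrite mul0r addr0; field.
Qed.

Lemma wirtinger_cayley_inv (R : realType) (w : R[i]) : w + 1 != 0 ->
  wirtinger (@cayley_inv R) w (2 / (w + 1) ^+ 2) 0.
Proof.
move=> z1 c t e ctz dc; rewrite -ctz in z1 *.
have d1 := curve_derive_cst 1 t.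
have := curve_deriveM (curve_deriveB dc d1)
  (@curve_deriveV _ (fun s => c s + 1) _ _ z1 (curve_deriveD dc d1)).
move/curve_derive_eq; apply.
by rewrite mul0r addr0; field.
Qed.

Lemma wirtinger_sqr (R : realType) (z : R[i]) :
  wirtinger (fun w => w ^+ 2) z (2 * z) 0.
Proof.
move=> c t e ctz dc; rewrite -ctz.
have -> : (fun w => w ^+ 2) \o c = (fun s => c s * c s).
  by apply/funext => s /=; rewrite expr2.
have := curve_deriveM dc dc.
by move/curve_derive_eq; apply; ring.
Qed.

(** Keeps the Wirtinger derivatives p and q visible, so that the map can be composed further;
    [K_quasiregular] hides them in an existential. *)
Definition C1_quasiregular (R : realType) (K : R) (f p q : R[i]^o -> R[i]^o) :=
  [/\ {in unit_disc R, continuous f}, {in unit_disc R, continuous p},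
      {in unit_disc R, continuous q},
      (forall z, unit_disc R z -> wirtinger f z (p z) (q z)) &
      forall z, unit_disc R z ->
        (normc (p z) + normc (q z)) ^+ 2 <=
          K * (normc (p z) ^+ 2 - normc (q z) ^+ 2)].

Lemma C1_quasiregularW (R : realType) (K : R) (f p q : R[i]^o -> R[i]^o) :
  C1_quasiregular K f p q -> K_quasiregular K f.
Proof. by case=> cf cp cq; exact: wirtinger_quasiregular. Qed.

(** An analytic outer map multiplies both Wirtinger derivatives by the same factor, so both sides of
    the dilatation inequality scale by its squared modulus and K is unchanged. It is applied twice:
    to the inverse Cayley transform and to g. *)
Lemma C1_quasiregular_comp (R : realType) (K : R)
    (U : set R[i]^o) (f p q g a : R[i]^o -> R[i]^o) :
  C1_quasiregular K f p q ->
  (forall z, unit_disc R z -> U (f z)) ->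
  {in U, continuous g} -> {in U, continuous a} ->
  (forall z, U z -> wirtinger g z (a z) 0) ->
  C1_quasiregular K (g \o f) (fun z => a (f z) * p z) (fun z => a (f z) * q z).
Proof.
move=> [cf cp cq fpq pqK] fD cg ca ga.
have caf : {in unit_disc R, continuous (a \o f)}.
  move=> z zD; apply: (continuous_comp (cf z zD)); apply: ca.
  by rewrite inE in zD; rewrite inE; exact: fD.
split.
- move=> z zD; apply: (continuous_comp (cf z zD)); apply: cg.
  by rewrite inE in zD; rewrite inE; exact: fD.
- by move=> z zD; exact: (cvgM (caf z zD) (cp z zD)).
- by move=> z zD; exact: (cvgM (caf z zD) (cq z zD)).
- by move=> z zD; apply: wirtinger_comp; [exact: fpq|exact/ga/fD].
move=> z zD; rewrite !normcM -mulrDr !exprMn -mulrBr [leRHS]mulrCA.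
by apply: ler_wpM2l; [exact: sqr_ge0|exact: pqK].
Qed.

(** * The radial stretch of the half-plane *)

Lemma conjc_continuous (R : realType) :
  continuous ((fun z => z^*%C) : R[i]^o -> R[i]^o).
Proof.
have -> : ((fun z => z^*%C) : R[i]^o -> R[i]^o) =
    (fun z => complex.Re z +i* - complex.Im z) by apply/funext => -[].
move=> z; apply: (@cvg_complex _ _ (nbhs z)); first exact: (@Re_continuous R z).
exact: (cvgN (@Im_continuous R z)).
Qed.

Lemma real_complex_continuous (R : realType) :
  continuous ((fun x => x%:C) : R -> R[i]^o).
Proof. by move=> x; apply: cvg_complex => /=;
  [exact: cvg_id|exact: cvg_cst]. Qed.

Lemma normc_sqr_continuous (R : realType) :
  continuous ((fun z => normc z ^+ 2) : R[i]^o -> R).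
Proof.
move=> z; have -> : (fun z : R[i]^o => normc z ^+ 2) =
    (fun z : R[i]^o => complex.Re z * complex.Re z + complex.Im z * complex.Im
      z).
  by apply/funext => w; rewrite normc_sqr.
exact: (cvgD (cvgM (@Re_continuous R z) (@Re_continuous R z))
  (cvgM (@Im_continuous R z) (@Im_continuous R z))).
Qed.

Lemma ccontM (R : realType) (T : topologicalType) (f g : T -> R[i]^o) (z : T) :
  {for z, continuous f} -> {for z, continuous g} ->
  {for z, continuous (fun x => f x * g x)}.
Proof. by move=> cf cg; exact: (@continuousM R[i] T f g z cf cg). Qed.

Lemma ccontD (R : realType) (T : topologicalType) (f g : T -> R[i]^o) (z : T) :
  {for z, continuous f} -> {for z, continuous g} ->
  {for z, continuous (fun x => f x + g x)}.
Proof. by move=> cf cg; exact: (@continuousD R[i] R[i]^o T f g z cf cg). Qed.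

Lemma ccontB (R : realType) (T : topologicalType) (f g : T -> R[i]^o) (z : T) :
  {for z, continuous f} -> {for z, continuous g} ->
  {for z, continuous (fun x => f x - g x)}.
Proof. by move=> cf cg; exact: (@continuousB R[i] R[i]^o T f g z cf cg). Qed.

Lemma ccontV (R : realType) (T : topologicalType) (f : T -> R[i]^o) (z : T) :
  f z != 0 -> {for z, continuous f} -> {for z, continuous (fun x => (f x)^-1)}.
Proof. by move=> f0 cf; exact: (@continuousV R[i] T f z f0 cf). Qed.

Lemma ccont_cst (R : realType) (T : topologicalType) (a : R[i]^o) (z : T) :
  {for z, continuous (fun=> a)}.
Proof. exact: cvg_cst. Qed.

Lemma ccont_id (R : realType) (z : R[i]^o) : {for z, continuous (fun x => x)}.
Proof. exact: cvg_id. Qed.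

Arguments ccont_cst {R T} a z.
Arguments ccont_id {R} z.

Definition right_half_plane (R : realType) : set R[i]^o :=
  [set w | 0 < complex.Re w].

Arguments right_half_plane R : clear implicits.

Lemma right_half_plane_neq0 (R : realType) (w : R[i]) :
  right_half_plane R w -> w != 0.
Proof. by move=> w0; apply/eqP => w00; move: w0;
  rewrite w00 /right_half_plane/= ltxx. Qed.

Lemma unit_discE (R : realType) (z : R[i]) :
  unit_disc R z = (normc z ^+ 2 < 1) :> Prop.
Proof. by rewrite expr_lt1// normc_ge0. Qed.

Lemma disc_neq1 (R : realType) (z : R[i]) : unit_disc R z -> 1 - z != 0.
Proof.
move=> z1; rewrite subr_eq0; apply/eqP => z1'; move: z1.
by rewrite -z1' /unit_disc/= expr0n expr1n addr0 sqrtr1 ltxx.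
Qed.

(** The real part of (1 + z) / (1 - z) is (1 - |z|^2) / |1 - z|^2. *)
Lemma cayley_right (R : realType) (z : R[i]) :
  unit_disc R z -> right_half_plane R (cayley z).
Proof.
move=> zD; have z1 := disc_neq1 zD; move: zD; rewrite unit_discE normc_sqr.
rewrite /right_half_plane/= /cayley invE; have := normc_gt0 z1.
move=> n0; have : 0 < (normc (1 - z) ^+ 2)^-1 by rewrite invr_gt0 exprn_gt0.
move: (_^-1) => k; case: z {z1 n0} => x y /= k0 xy.
have -> : (1 + x) * (k * (1 - x) - 0 * - (0 - y)) - (0 + y) * (k * - (0 - y) +
  0 * (1 - x))
  = k * (1 - (x ^+ 2 + y ^+ 2)) by ring.
by rewrite mulr_gt0// subr_gt0.
Qed.

(** A point of positive real part is closer to 1 than to -1. *)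
Lemma cayley_inv_disc (R : realType) (w : R[i]) :
  right_half_plane R w -> w + 1 != 0 /\ unit_disc R (cayley_inv w).
Proof.
move=> w0.
have w1 : w + 1 != 0.
  apply/eqP => w1; have : complex.Re (w + 1) = 0 by rewrite w1.
  by move: w0 {w1}; rewrite /right_half_plane; case: w => x y /=; lra.
split=> //; rewrite unit_discE /cayley_inv normcM normcV exprMn exprVn.
rewrite ltr_pdivrMr ?exprn_gt0 ?normc_gt0// mul1r !normc_sqr.
by move: w0 {w1}; rewrite /right_half_plane; case: w => x y /=; nra.
Qed.

Lemma radial_cbrt_right (R : realType) (w : R[i]) :
  right_half_plane R w -> right_half_plane R (radial_cbrt w).
Proof.
move=> w0; have n0 : 0 < normc w ^+ 2.
  by rewrite exprn_gt0// normc_gt0// right_half_plane_neq0.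
have := cbrt_inv_gt0 n0; rewrite /right_half_plane/= /radial_cbrt.
move: (cbrt_inv _) => l l0; case: w w0 {n0} => x y; rewrite /right_half_plane/=.
by rewrite mul0r subr0; exact: mulr_gt0.
Qed.

Lemma cayley_invK (R : realType) (w : R[i]) : w + 1 != 0 ->
  cayley (cayley_inv w) = w.
Proof.
move=> w1; rewrite /cayley /cayley_inv.
have -> : 1 + (w - 1) / (w + 1) = 2 * w / (w + 1) by field.
have -> : 1 - (w - 1) / (w + 1) = 2 / (w + 1) by field.
by field.
Qed.

Lemma cbrt_inv_continuous (R : realType) (u : R[i]^o) : u != 0 ->
  {for u, continuous ((fun z => (cbrt_inv (normc z ^+ 2))%:C) : R[i]^o ->
    R[i]^o)}.
Proof.
move=> u0; have n0 : 0 < normc u ^+ 2 by rewrite exprn_gt0// normc_gt0.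
have cl : {for normc u ^+ 2, continuous (@cbrt_inv R)}.
  apply: differentiable_continuous; apply/derivable1_diffP.
  by have [] := is_derive_cbrt_inv n0.
apply: (@continuous_comp _ _ _ (fun z : R[i]^o => cbrt_inv (normc z ^+ 2))
  (fun x => x%:C : R[i]^o)); last exact: real_complex_continuous.
by apply: (continuous_comp (@normc_sqr_continuous R u)).
Qed.

Lemma normc_real (R : realType) (x : R) : 0 <= x -> normc (x%:C) = x.
Proof. by move=> x0; rewrite /= expr0n addr0 sqrtr_sqr ger0_norm. Qed.

(** This is |P(u)| = |u|^(1/3), cubed to avoid fractional powers and valid at 0 too. It gives the
    continuity of P at the origin and later the growth of P(W). *)
Lemma normc_radial_cbrtX3 (R : realType) (u : R[i]) :
  normc (radial_cbrt u) ^+ 3 = normc u.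
Proof.
rewrite /radial_cbrt normcM normc_real ?powR_ge0// exprMn cbrt_invK ?sqr_ge0//.
have [->|u0] := eqVneq u 0; first by rewrite normc0 !expr0n mulr0.
by have := normc_gt0 u0 => n0; field; rewrite gt_eqF.
Qed.

Lemma radial_cbrt_continuous (R : realType) : continuous (@radial_cbrt R).
Proof.
move=> u; have [->|u0] := eqVneq u 0; last first.
  exact: (ccontM (cbrt_inv_continuous u0) (ccont_id u)).
have P0 : radial_cbrt (0 : R[i]^o) = 0 by exact: mulr0.
rewrite /continuous_at P0; apply/(@cvgrPdist_lt _ _ _ (nbhs (0 : R[i]^o))) => e.
rewrite ltcE => /andP[/= /eqP ie re].
have -> : e = (complex.Re e)%:C by case: e ie {re} => a b /= ->.
(* At the origin, |P(w)| < e amounts to |w| < e^3. *)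
have e3 : 0 < complex.Re e ^+ 3 by rewrite exprn_gt0.
near=> w.
rewrite sub0r normrN cnormE ltcR -(ltr_pXn2r (n :=
  3)) ?nnegrE ?normc_ge0 ?(ltW re)//.
rewrite normc_radial_cbrtX3 -normcN -[- w]sub0r.
by near: w; exact: near_normc.
Unshelve. all: by end_near. Qed.

Lemma cayley_continuous (R : realType) (z : R[i]^o) : 1 - z != 0 ->
  {for z, continuous (@cayley R)}.
Proof.
move=> z1.
have c1 := ccont_cst (1 : R[i]^o) z; have cz := ccont_id z.
have cn := ccontD c1 cz; have cd := ccontB c1 cz.
have cV := @ccontV _ _ (fun x : R[i]^o => 1 - x) z z1 cd.
exact: (ccontM cn cV).
Qed.

Lemma cayley_inv_continuous (R : realType) (w : R[i]^o) : w + 1 != 0 ->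
  {for w, continuous (@cayley_inv R)}.
Proof.
move=> w1.
have c1 := ccont_cst (1 : R[i]^o) w; have cw := ccont_id w.
have cn := ccontB cw c1; have cd := ccontD cw c1.
have cV := @ccontV _ _ (fun x : R[i]^o => x + 1) w w1 cd.
exact: (ccontM cn cV).
Qed.

Lemma radial_cbrt_dz_continuous (R : realType) (u : R[i]^o) : u != 0 ->
  {for u, continuous (@radial_cbrt_dz R)}.
Proof.
move=> u0; have -> : @radial_cbrt_dz R =
    (fun z => (2 / 3)%:C * (cbrt_inv (normc z ^+ 2))%:C).
  by apply/funext => z; rewrite -rmorphM.
exact: (ccontM (ccont_cst ((2 / 3)%:C : R[i]^o) u) (cbrt_inv_continuous u0)).
Qed.

Lemma radial_cbrt_dzbar_continuous (R : realType) (u : R[i]^o) : u != 0 ->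
  {for u, continuous (@radial_cbrt_dzbar R)}.
Proof.
move=> u0; have -> : @radial_cbrt_dzbar R =
    (fun z => (- 3^-1)%:C * (cbrt_inv (normc z ^+ 2))%:C * (z / z^*%C)).
  by apply/funext => z; rewrite -rmorphM.
exact: (ccontM (ccontM (ccont_cst ((- 3^-1)%:C : R[i]^o) u)
    (cbrt_inv_continuous u0))
  (ccontM (ccont_id u) (@ccontV _ _ (fun x : R[i]^o => x^*%C :
    R[i]^o) u (conj_neq0 u0)
      (@conjc_continuous R u)))).
Qed.

Lemma normc_conjc (R : realType) (z : R[i]) : normc z^*%C = normc z.
Proof. by case: z => a b; rewrite /= sqrrN. Qed.

Lemma normc_radial_cbrt_dz (R : realType) (u : R[i]) :
  normc (radial_cbrt_dz u) = 2 / 3 * cbrt_inv (normc u ^+ 2).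
Proof. by rewrite normc_real// mulr_ge0 ?powR_ge0. Qed.

Lemma normc_radial_cbrt_dzbar (R : realType) (u : R[i]) : u != 0 ->
  normc (radial_cbrt_dzbar u) = 3^-1 * cbrt_inv (normc u ^+ 2).
Proof.
move=> u0; have n0 : normc u != 0 by rewrite gt_eqF// normc_gt0.
rewrite /radial_cbrt_dzbar; move: (cbrt_inv_gt0 (exprn_gt0 2 (normc_gt0 u0))).
move: (cbrt_inv _) => l l0; rewrite mulNr rmorphN mulNr normcN.
rewrite normcM [normc (u / _)]normcM normcV normc_conjc mulfV// mulr1.
by rewrite normc_real// mulr_ge0// ltW.
Qed.

Definition cayley_dz (R : realType) (z : R[i]^o) : R[i]^o := 2 / (1 - z) ^+ 2.

Lemma cayley_dz_continuous (R : realType) (z : R[i]^o) : 1 - z != 0 ->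
  {for z, continuous (@cayley_dz R)}.
Proof.
move=> z1; have c1 := ccontB (ccont_cst (1 : R[i]^o) z) (ccont_id z).
have z2 : (1 - z) * (1 - z) != 0 by rewrite mulf_neq0.
have -> : @cayley_dz R = (fun z => 2 * ((1 - z) * (1 - z))^-1).
  by apply/funext => w; rewrite /cayley_dz expr2.
exact: (ccontM (ccont_cst (2 : R[i]^o) z) 
  (@ccontV _ _ (fun x : R[i]^o => (1 - x) * (1 - x)) z z2 (ccontM c1 c1))).
Qed.

Lemma radial_cayley_C1_quasiregular (R : realType) :
  C1_quasiregular 3 (@radial_cbrt R \o @cayley R)
    (fun z => radial_cbrt_dz (cayley z) * cayley_dz z)
    (fun z => radial_cbrt_dzbar (cayley z) * (cayley_dz z)^*%C).
Proof.
have W0 z : z \in unit_disc R -> cayley z != 0.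
  by rewrite inE => zD; exact/right_half_plane_neq0/cayley_right.
have z1 z : z \in unit_disc R -> 1 - z != 0.
  by rewrite inE; exact: disc_neq1.
have cW z (zD : z \in unit_disc R) := cayley_continuous (z1 z zD).
have cW' z (zD : z \in unit_disc R) := cayley_dz_continuous (z1 z zD).
split.
- by move=> z zD; exact: (continuous_comp (cW z zD) (@radial_cbrt_continuous R
  _)).
- move=> z zD.
  exact: (ccontM (continuous_comp (cW z zD) (radial_cbrt_dz_continuous (W0 z
    zD)))
    (cW' z zD)).
- move=> z zD.
  exact: (ccontM (continuous_comp (cW z zD) (radial_cbrt_dzbar_continuous (W0 z
    zD)))
    (continuous_comp (cW' z zD) (@conjc_continuous R _))).
- move=> z; rewrite -inE => zD; apply: wirtinger_comp_holo.
    exact: wirtinger_cayley (z1 z zD).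
  exact: wirtinger_radial_cbrt (W0 z zD).
move=> z; rewrite -inE => /W0; set u := cayley z => u0.
rewrite (normcM (radial_cbrt_dz u)) (normcM (radial_cbrt_dzbar u)) normc_conjc.
rewrite normc_radial_cbrt_dz normc_radial_cbrt_dzbar//.
move: (normc _) (cbrt_inv _) => a l.
(* Equality holds with K = 3: up to the common factor, the left side is (2/3 + 1/3)^2 = 1 and the
   right side is 3 (4/9 - 1/9). *)
by rewrite le_eqVlt; apply/orP; left; apply/eqP; field.
Qed.

Definition stretch (R : realType) : R[i]^o -> R[i]^o :=
  @cayley_inv R \o (@radial_cbrt R \o @cayley R).

(** * The quasiconformal homeomorphism of the disc *)

(** The properties shared by P and Q, so that one argument covers both the extension of phi and its
    inverse. The factor [rho] may vanish at 0 only. *)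
Definition radial_morphism (R : realType) (r : R[i]^o -> R[i]^o) : Prop :=
  [/\ exists rho : R[i] -> R, forall u,
        [/\ 0 <= rho u, u != 0 -> 0 < rho u & r u = (rho u)%:C * u],
      forall u v, r (u * v) = r u * r v & continuous r].

(* [r] read in the coordinate (1 + z) / (1 - z), in a form that also makes sense
   at z = 1. *)
Definition disc_map (R : realType) (r : R[i]^o -> R[i]^o) (z : R[i]^o) :
  R[i]^o :=
  (r (1 + z) - r (1 - z)) / (r (1 + z) + r (1 - z)).

Lemma normc_sqrD (R : realType) (a b : R[i]) :
  normc (a + b) ^+ 2 =
  normc a ^+ 2 + normc b ^+ 2 + 2 * complex.Re (a * b^*%C).
Proof. by rewrite !normc_sqr; case: a => x y; case: b => x' y' /=; ring. Qed.

Lemma normc_sqrB (R : realType) (a b : R[i]) :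
  normc (a - b) ^+ 2 =
  normc a ^+ 2 + normc b ^+ 2 - 2 * complex.Re (a * b^*%C).
Proof. by rewrite !normc_sqr; case: a => x y; case: b => x' y' /=; ring. Qed.

Lemma radial_eq0 (R : realType) (r : R[i]^o -> R[i]^o) (u : R[i]^o) :
  radial_morphism r -> r u = 0 -> u = 0.
Proof.
move=> [[rho H] _ _] /eqP; have [_ rho0 ->] := H u;
  rewrite mulf_eq0 => /orP[|/eqP//].
have [-> //|/rho0 u0] := eqVneq u 0; rewrite -(rmorph0 (real_complex R)).
by rewrite (inj_eq (@complexI _)) gt_eqF.
Qed.

Lemma radial_Re (R : realType) (r : R[i]^o -> R[i]^o) (z : R[i]^o) :
  radial_morphism r ->
  let t := complex.Re (r (1 + z) * (r (1 - z))^*%C) in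
  (normc z <= 1 -> 0 <= t) /\ (normc z < 1 -> 0 < t).
Proof.
move=> [[rho H] _ _] /=.
have [a0 a1 ->] := H (1 + z); have [b0 b1 ->] := H (1 - z).
have -> : complex.Re ((rho (1 + z))%:C * (1 + z) *
      ((rho (1 - z))%:C * (1 - z))^*%C) =
    rho (1 + z) * rho (1 - z) * (1 - normc z ^+ 2).
  move: (rho _) (rho _) => a b; rewrite normc_sqr; case: (z) => x y /=; ring.
split=> z1; first by rewrite !mulr_ge0// subr_ge0 expr_le1// normc_ge0.
have z0 : 1 - z != 0 by exact: disc_neq1.
have z0' : 1 + z != 0.
  by rewrite -[z]opprK; apply: disc_neq1; rewrite /unit_disc/= normcN.
by rewrite !mulr_gt0 ?a1 ?b1// subr_gt0 expr_lt1// normc_ge0.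
Qed.

Lemma disc_map_den_neq0 (R : realType) (r : R[i]^o -> R[i]^o) (z : R[i]^o) :
  radial_morphism r -> closed_unit_disc R z -> r (1 + z) + r (1 - z) != 0.
Proof.
move=> rr z1; apply/eqP => S0.
have [/(_ z1) t0 _] := radial_Re z rr.
have := normc_sqrD (r (1 + z)) (r (1 - z)); rewrite S0 normc0 expr0n/=.
have a0 := normc_ge0 (r (1 + z)); have b0 := normc_ge0 (r (1 - z)) => E.
have az : normc (r (1 + z)) = 0 by nra.
have bz : normc (r (1 - z)) = 0 by nra.
have pz := radial_eq0 rr (eq0_normc az).
have mz := radial_eq0 rr (eq0_normc bz).
have : (2 : R[i]) = 0 by rewrite -(addr0 0) -{1}pz -mz; ring.
by move/eqP; rewrite pnatr_eq0.
Qed.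

Lemma normc_disc_map (R : realType) (r : R[i]^o -> R[i]^o) (z : R[i]^o) :
  radial_morphism r ->
  (closed_unit_disc R z -> closed_unit_disc R (disc_map r z)) /\
  (unit_disc R z -> unit_disc R (disc_map r z)).
Proof.
move=> rr; have [tc to] := radial_Re z rr.
rewrite /unit_disc /closed_unit_disc/=.
split=> z1.
  have S0 := normc_gt0 (disc_map_den_neq0 rr z1).
  rewrite normcM normcV ler_pdivrMr// mul1r -(ler_pXn2r (n :=
    2)) ?nnegrE ?normc_ge0//.
  by rewrite normc_sqrB normc_sqrD; have := tc z1; lra.
have S0 := normc_gt0 (disc_map_den_neq0 rr (ltW z1)).
rewrite normcM normcV ltr_pdivrMr// mul1r -(ltr_pXn2r (n :=
  2)) ?nnegrE ?normc_ge0//.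
by rewrite normc_sqrB normc_sqrD; have := to z1; lra.
Qed.

Lemma disc_map_continuous (R : realType) (r : R[i]^o -> R[i]^o) (z : R[i]^o) :
  radial_morphism r -> closed_unit_disc R z -> {for z, continuous (disc_map r)}.
Proof.
move=> rr z1; have S0 := disc_map_den_neq0 rr z1; case: rr => _ _ cr.
have c1 := ccont_cst (1 : R[i]^o) z; have cz := ccont_id z.
have cp := continuous_comp (ccontD c1 cz) (cr _).
have cm := continuous_comp (ccontB c1 cz) (cr _).
have cV := @ccontV _ _ (fun x :
  R[i]^o => r (1 + x) + r (1 - x)) z S0 (ccontD cp cm).
exact: (ccontM (ccontB cp cm) cV).
Qed.

(** With w = [disc_map r z], 1 + w and 1 - w are r (1 + z) and r (1 - z) times one common factor. By
    multiplicativity the image of that factor under s cancels in the quotient. *)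
Lemma disc_mapK (R : realType) (r s : R[i]^o -> R[i]^o) (z : R[i]^o) :
  radial_morphism r -> radial_morphism s -> cancel r s ->
  closed_unit_disc R z -> disc_map s (disc_map r z) = z.
Proof.
move=> rr sr rsK z1; have S0 := disc_map_den_neq0 rr z1.
have [_ sM _] := sr.
have E1 : 1 + disc_map r z = 2 / (r (1 + z) + r (1 - z)) * r (1 + z).
  by rewrite /disc_map; field.
have E2 : 1 - disc_map r z = 2 / (r (1 + z) + r (1 - z)) * r (1 - z).
  by rewrite /disc_map; field.
have k0 : s (2 / (r (1 + z) + r (1 - z))) != 0.
  apply/eqP => /(radial_eq0 sr)/eqP; rewrite mulf_eq0 invr_eq0 (negbTE S0).
  by rewrite pnatr_eq0.
rewrite {1}/disc_map E1 E2 !sM !rsK -mulrBr -mulrDr.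
have -> : 1 + z - (1 - z) = 2 * z by ring.
have -> : 1 + z + (1 - z) = 2 by ring.
field; rewrite andbC -negb_or -mulf_eq0 -sM; exact: k0.
Qed.

Lemma disc_map_homeomorphic (R : realType) (r s : R[i]^o -> R[i]^o) :
  radial_morphism r -> radial_morphism s -> cancel r s -> cancel s r ->
  homeomorphic_inverses (closed_unit_disc R) (closed_unit_disc R)
    (disc_map r) (disc_map s).
Proof.
move=> rr sr rsK srK.
have cr : {in closed_unit_disc R, continuous (disc_map r)}.
  by move=> z; rewrite inE => z1; exact: (disc_map_continuous rr z1).
have cs : {in closed_unit_disc R, continuous (disc_map s)}.
  by move=> z; rewrite inE => z1; exact: (disc_map_continuous sr z1).
split.
- exact: (@continuous_in_subspaceT _ _ _ _ cr).
- exact: (@continuous_in_subspaceT _ _ _ _ cs).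
- by move=> z z1; split; [exact: (normc_disc_map z rr).1|exact: disc_mapK].
- by move=> z z1; split; [exact: (normc_disc_map z sr).1|exact: disc_mapK].
Qed.

(** * The mutually inverse stretches P and Q and the map phi *)

Definition radial_cube (R : realType) (u : R[i]^o) : R[i]^o :=
  (normc u ^+ 2)%:C * u.

Lemma radial_cbrt_morphism (R : realType) : radial_morphism (@radial_cbrt R).
Proof.
split.
- exists (fun u => cbrt_inv (normc u ^+ 2)) => u; split => //.
    exact: powR_ge0.
  by move=> u0; rewrite cbrt_inv_gt0// exprn_gt0// normc_gt0.
- move=> u v; rewrite /radial_cbrt normcM exprMn cbrt_invM ?sqr_ge0// rmorphM.
  ring.
- exact: radial_cbrt_continuous.
Qed.

Lemma radial_cube_morphism (R : realType) : radial_morphism (@radial_cube R).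
Proof.
split.
- exists (fun u => normc u ^+ 2) => u; split => //; first exact: sqr_ge0.
  by move=> u0; rewrite exprn_gt0// normc_gt0.
- move=> u v; rewrite /radial_cube normcM exprMn rmorphM.
  ring.
- move=> u; have c := continuous_comp (@normc_sqr_continuous R u)
    (@real_complex_continuous R _).
  exact: (ccontM c (ccont_id u)).
Qed.

Lemma radial_cbrtK (R : realType) : cancel (@radial_cbrt R) (@radial_cube R).
Proof.
move=> u; rewrite /radial_cube /radial_cbrt normcM normc_real ?powR_ge0//.
have [->|u0] := eqVneq u 0; first by rewrite !mulr0.
have n0 : normc u ^+ 2 != 0 by rewrite expf_neq0// gt_eqF// normc_gt0.
have E := cbrt_invK (sqr_ge0 (normc u)).
rewrite mulrA -rmorphM/=; move: (cbrt_inv _) E => l E.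
have -> : (l * normc u) ^+ 2 * l = 1 by rewrite exprMn mulrAC -exprSr E mulVf.
by rewrite mul1r.
Qed.

Lemma radial_cubeK (R : realType) : cancel (@radial_cube R) (@radial_cbrt R).
Proof.
move=> u; rewrite /radial_cube /radial_cbrt normcM normc_real ?sqr_ge0//.
have [->|u0] := eqVneq u 0; first by rewrite !mulr0.
have n0 : normc u != 0 by rewrite gt_eqF// normc_gt0.
rewrite -exprSr -exprM mulnC exprM cbrt_invX3 ?sqr_ge0//.
by rewrite mulrA -rmorphM/= mulVf ?mul1r// expf_neq0.
Qed.

(** In the open disc one may divide numerator and denominator by P(1 - z), and P(1 + z) / P(1 - z) =
    P(W(z)) by multiplicativity. *)
Lemma stretchE (R : realType) (z : R[i]^o) : unit_disc R z ->
  disc_map (@radial_cbrt R) z = stretch z.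
Proof.
move=> zD; have z1 := disc_neq1 zD.
have S0 := disc_map_den_neq0 (radial_cbrt_morphism R) (ltW zD).
have [_ rM _] := radial_cbrt_morphism R.
have E : radial_cbrt (1 + z) = radial_cbrt (cayley z) * radial_cbrt (1 - z).
  by rewrite -rM /cayley mulfVK.
have w1 := (cayley_inv_disc (radial_cbrt_right (cayley_right zD))).1.
rewrite /disc_map /stretch/= /cayley_inv E.
rewrite E in S0; field; rewrite w1; exact: S0.
Qed.

Lemma stretch_disc (R : realType) (z : R[i]^o) :
  unit_disc R z -> unit_disc R (stretch z).
Proof.
move=> zD; rewrite -stretchE//.
exact: (normc_disc_map z (radial_cbrt_morphism R)).2.
Qed.

Definition cayley_inv_dz (R : realType) (w : R[i]^o) : R[i]^o :=
  2 / (w + 1) ^+ 2.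

Lemma cayley_inv_dz_continuous (R : realType) (w : R[i]^o) : w + 1 != 0 ->
  {for w, continuous (@cayley_inv_dz R)}.
Proof.
move=> w1; have c1 := ccontD (ccont_id w) (ccont_cst (1 : R[i]^o) w).
have w2 : (w + 1) * (w + 1) != 0 by rewrite mulf_neq0.
have -> : @cayley_inv_dz R = (fun z => 2 * ((z + 1) * (z + 1))^-1).
  by apply/funext => z; rewrite /cayley_inv_dz expr2.
exact: (ccontM (ccont_cst (2 : R[i]^o) w)
  (@ccontV _ _ (fun x : R[i]^o => (x + 1) * (x + 1)) w w2 (ccontM c1 c1))).
Qed.

Lemma stretch_C1_quasiregular (R : realType) :
  exists p q, C1_quasiregular 3 (@stretch R) p q.
Proof.
eexists; eexists.
apply: (@C1_quasiregular_comp _ _ (right_half_plane R) _ _ _ _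
  (@cayley_inv_dz R) (radial_cayley_C1_quasiregular R)).
- by move=> z zD; exact/radial_cbrt_right/cayley_right.
- move=> w; rewrite inE => w0.
  exact: (cayley_inv_continuous (cayley_inv_disc w0).1).
- move=> w; rewrite inE => w0.
  exact: (cayley_inv_dz_continuous (cayley_inv_disc w0).1).
- by move=> w w0; exact: (wirtinger_cayley_inv (cayley_inv_disc w0).1).
Qed.

Lemma stretch_extension (R : realType) :
  closed_disc_extension (@stretch R) (disc_map (@radial_cbrt R))
    (disc_map (@radial_cube R)).
Proof.
split; last by move=> z; exact: stretchE.
apply: disc_map_homeomorphic.
- exact: radial_cbrt_morphism.
- exact: radial_cube_morphism.
- exact: radial_cbrtK.
- exact: radial_cubeK.
Qed.

Lemma stretch_image (R : realType) : @stretch R @` unit_disc R = unit_disc R.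
Proof.
apply/seteqP; split=> [_ [z zD <-]|w wD]; first exact: stretch_disc.
have vD := (normc_disc_map w (radial_cube_morphism R)).2 wD.
exists (disc_map (@radial_cube R) w) => //; rewrite -stretchE//.
apply: disc_mapK; [exact: radial_cube_morphism|exact: radial_cbrt_morphism
  |exact: radial_cubeK|exact: ltW].
Qed.

Lemma stretch_quasiconformal (R : realType) : quasiconformal (@stretch R).
Proof.
have [p [q sqr]] := stretch_C1_quasiregular R.
exists 3; first by lra.
split; first exact: (C1_quasiregularW sqr).
exists (disc_map (@radial_cube R)); rewrite stretch_image.
have [cs _ _ _ _] := sqr; have cub := radial_cube_morphism R.
have cK : {in unit_disc R, continuous (disc_map (@radial_cube R))}.
  by move=> z; rewrite inE => zD; exact: (disc_map_continuous cub (ltW zD)).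
split.
- exact: (@continuous_in_subspaceT _ _ _ _ cs).
- exact: (@continuous_in_subspaceT _ _ _ _ cK).
- move=> z zD; split; first exact: stretch_disc.
  rewrite -stretchE//; apply: disc_mapK; [exact: radial_cbrt_morphism
    |exact: radial_cube_morphism|exact: radial_cbrtK|exact: ltW].
- move=> z zD; have vD := (normc_disc_map z cub).2 zD; split => //.
  rewrite -stretchE//; apply: disc_mapK; [exact: radial_cube_morphism
    |exact: radial_cbrt_morphism|exact: radial_cubeK|exact: ltW].
Qed.

(** On the circle |1 + z|^2 = 2 (1 + x) and |1 - z|^2 = 2 (1 - x) with x = Re z. The sum and
    difference of Q(1 + z) and Q(1 - z) then share a factor 4, which cancels. *)
Lemma disc_map_cube_circle (R : realType) (z : R[i]^o) : unit_circle R z ->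
  1 + (complex.Re z)%:C * z != 0 /\
  disc_map (@radial_cube R) z =
    (z + (complex.Re z)%:C) / (1 + (complex.Re z)%:C * z).
Proof.
move=> z1; have zc : closed_unit_disc R z by rewrite /closed_unit_disc/= z1.
have := disc_map_den_neq0 (radial_cube_morphism R) zc.
have n1 : complex.Re z ^+ 2 + complex.Im z ^+ 2 = 1 by rewrite -normc_sqr z1
  expr1n.
have Ep : normc (1 + z) ^+ 2 = 2 * (1 + complex.Re z).
  by rewrite normc_sqr; case: (z) n1 => x y /=; lra.
have Em : normc (1 - z) ^+ 2 = 2 * (1 - complex.Re z).
  by rewrite normc_sqr; case: (z) n1 => x y /=; lra.
have EC (a : R) : (2 * (1 + a))%:C = 2 * (1 + a%:C) :> R[i].
  by apply/eqP; rewrite eq_complex /=; apply/andP; split; apply/eqP; ring.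
rewrite /disc_map /radial_cube Ep Em !EC rmorphN; set x := (complex.Re z)%:C.
have -> : 2 * (1 + x) * (1 + z) + 2 * (1 - x) * (1 - z) = 4 * (1 + x * z) by
  ring.
have -> : 2 * (1 + x) * (1 + z) - 2 * (1 - x) * (1 - z) = 4 * (z + x) by ring.
rewrite mulf_eq0 negb_or => /andP[_ x0]; split => //.
by field.
Qed.

(** The denominators satisfy |1 + x z|^2 = 1 + 3 x^2 >= 1. The numerator of the difference splits
    into a multiple of z - w and one of x - y, each with a cofactor of modulus at most 2; as |x - y|
    <= |z - w|, the constant is 2 + 2 = 4. *)
Lemma disc_map_cube_lipschitz (R : realType) :
  [lipschitz disc_map (@radial_cube R) w | w in unit_circle R].
Proof.
have one : unit_circle R 1 by exact: normc1.
apply: (@klipschitzW _ _ _ 4).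
  (* The filter on pairs of circle points is proper because the pair (1, 1) exists. *)
  exact: (@globally_properfilter _ _ (1, 1)).
move=> [z w] /= [z1 w1].
have [z0 ->] := disc_map_cube_circle z1; have [w0 ->] :=
  disc_map_cube_circle w1.
set x := complex.Re z in z0 *; set y := complex.Re w in w0 *.
have den (u : R[i]) : unit_circle R u ->
    1 <= normc (1 + (complex.Re u)%:C * u) /\ `|complex.Re u| <= 1.
  move=> u1; split; last by rewrite -u1; exact: Re_le_normc.
  rewrite -(ler_pXn2r (n := 2)) ?nnegrE ?normc_ge0// expr1n.
  have : complex.Re u ^+ 2 + complex.Im u ^+ 2 = 1 by rewrite -normc_sqr u1
    expr1n.
  rewrite normc_sqr; case: u u1 => a b _ /= ab.
  have -> : (1 + (a * a - 0 * b)) ^+ 2 + (0 + (a * b + 0 * a)) ^+ 2 =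
    1 + 2 * a ^+ 2 + a ^+ 2 * (a ^+ 2 + b ^+ 2) by ring.
  by rewrite ab; have := sqr_ge0 a; lra.
have [dz xz] := den z z1; have [dw yw] := den w w1.
have -> : (z + x%:C) / (1 + x%:C * z) - (w + y%:C) / (1 + y%:C * w) =
    ((z - w) * (1 - x%:C * y%:C) + (x%:C - y%:C) * (1 - z * w)) /
    ((1 + x%:C * z) * (1 + y%:C * w)).
  by field; apply/andP; split; [exact: w0|exact: z0].
have xy : normc (x%:C - y%:C) <= normc (z - w).
  rewrite -rmorphB /= expr0n addr0 sqrtr_sqr -ReB; exact: Re_le_normc.
have b1 : normc (1 - x%:C * y%:C) <= 2.
  apply: le_trans (le_normcD _ _) _; rewrite normcN normc1 normcM /=.
  rewrite !expr0n !addr0 !sqrtr_sqr.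
  by have := normr_ge0 x; have := normr_ge0 y; nra.
have b2 : normc (1 - z * w) <= 2.
  by apply: le_trans (le_normcD _ _) _;
    rewrite normcN normc1 normcM z1 w1 mulr1.
suff : normc (((z - w) * (1 - x%:C * y%:C) + (x%:C - y%:C) * (1 - z * w)) /
    ((1 + x%:C * z) * (1 + y%:C * w))) <= 4 * normc (z - w).
  by rewrite -lecR rmorphM rmorph_nat.
rewrite normcM normcV normcM.
have d1 : 1 <= normc (1 + x%:C * z) * normc (1 + y%:C * w) by nra.
rewrite ler_pdivrMr; last exact: lt_le_trans d1.
have N0 := normc_ge0 (z - w).
apply: (@le_trans _ _ (4 * normc (z - w))); last by nra.
apply: le_trans (le_normcD _ _) _; rewrite !normcM.
have := normc_ge0 (1 - x%:C * y%:C); have := normc_ge0 (1 - z * w).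
have := normc_ge0 (x%:C - y%:C).
nra.
Qed.

(** * Circle means *)

Lemma sin_MVT (R : realType) (t : R) : 0 <= t ->
  exists2 c, c \in `[0, t] & sin t = cos c * t.
Proof.
move=> t0.
have [c ct E] := @MVT_segment R (@sin R) (@cos R) 0 t t0
  (fun x _ => is_derive_sin x) (continuous_subspaceT (@continuous_sin R)).
by exists c => //; move: E; rewrite sin0 !subr0.
Qed.

Lemma one_sub_cos (R : realType) (t : R) : 1 - cos t = 2 * sin (t / 2) ^+ 2.
Proof.
have t2 : t / 2 *+ 2 = t by rewrite mulr2n; lra.
have := cos_mulr2n (t / 2); rewrite t2 => ->.
by rewrite cos2sin2 mulr2n; ring.
Qed.

Lemma one_sub_cos_le (R : realType) (t : R) : 0 <= t -> 1 - cos t <= t ^+ 2 / 2.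
Proof.
move=> t0; have t2 : 0 <= t / 2 by rewrite divr_ge0.
rewrite one_sub_cos; have [c _ ->] := sin_MVT t2.
have -> : 2 * (cos c * (t / 2)) ^+ 2 = cos c ^+ 2 * (t ^+ 2 / 2) by field.
by rewrite ler_piMl ?divr_ge0 ?sqr_ge0// cos2sin2 gerBl sqr_ge0.
Qed.

(** For t <= 2, sin (t / 2) = cos c * t / 2 with c <= 1, hence cos c >= 1/2 and 1 - cos t >= t^2 /
    8. Beyond 2, monotonicity gives 1 - cos t >= 1 - cos 2 >= 1/2, and t < 4 yields t^2 / 32 <=
    1/2. *)
Lemma one_sub_cos_ge (R : realType) (t : R) : 0 <= t <= pi ->
  t ^+ 2 / 32 <= 1 - cos t.
Proof.
move=> /andP[t0 tpi]; have pi4 : pi < 4 :> R by have := pihalf_lt2 R; lra.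
have small (x : R) : 0 <= x <= 2 -> x ^+ 2 / 8 <= 1 - cos x.
  move=> /andP[x0 x2]; have h0 : 0 <= x / 2 by rewrite divr_ge0.
  rewrite one_sub_cos; have [c + ->] := sin_MVT h0.
  rewrite in_itv/= => /andP[c0 cx].
  have := one_sub_cos_le c0 => cc.
  have c2 : 1 / 2 <= cos c by nra.
  have : 1 / 4 <= cos c ^+ 2 by nra.
  have -> : 2 * (cos c * (x / 2)) ^+ 2 = cos c ^+ 2 * (x ^+ 2 / 2) by field.
  by have := sqr_ge0 x; move: (cos c ^+ 2) (x ^+ 2) => k y; nra.
have [t2|t2] := leP t 2.
  by have := small t; rewrite t0 t2 => /(_ isT); have := sqr_ge0 t; lra.
have c2 := small 2; rewrite lexx ler0n in c2.
have ct : cos t <= cos 2.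
  have tI : t \in `[0, pi] by rewrite in_itv/= t0 tpi.
  have twoI : 2 \in `[0, pi : R] by rewrite in_itv/= ler0n pi_ge2.
  by rewrite ltW// (ltr_cos twoI tI).
have := c2 isT; nra.
Qed.

Definition circle_point (R : realType) (r t : R) : R[i]^o :=
  r%:C * (cos t +i* sin t).

Lemma normc_circle_point (R : realType) (r t : R) : 0 <= r ->
  normc (circle_point r t) = r.
Proof.
move=> r0; rewrite normcM normc_real//= cos2Dsin2 sqrtr1 mulr1//.
Qed.

Lemma normc_one_sub_circle (R : realType) (r t : R) :
  normc (1 - circle_point r t) ^+ 2 = (1 - r) ^+ 2 + 2 * r * (1 - cos t).
Proof.
rewrite normc_sqr /circle_point /=; have := cos2Dsin2 t => /=.
move: (cos t) (sin t) => c s cs.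
have -> : (1 - (r * c - 0 * s)) ^+ 2 + (0 - (r * s + 0 * c)) ^+ 2 =
  1 - 2 * r * c + r ^+ 2 * (c ^+ 2 + s ^+ 2) by ring.
by rewrite cs; ring.
Qed.

Lemma normc_continuous (R : realType) : continuous (@normc R : R[i]^o -> R).
Proof.
move=> z; have -> : (@normc R : R[i]^o ->
  R) = (fun z => Num.sqrt (normc z ^+ 2)).
  by apply/funext => w; rewrite sqrtr_sqr ger0_norm ?normc_ge0.
exact: (continuous_comp (@normc_sqr_continuous R z) (@sqrt_continuous R _)).
Qed.

Lemma circle_point_continuous (R : realType) (r : R) :
  continuous (circle_point r).
Proof.
move=> t.
have c : {for t, continuous ((fun t => cos t +i* sin t) : R -> R[i]^o)}.
  by apply: (@cvg_complex _ _ (nbhs t));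
    [exact: continuous_cos|exact: continuous_sin].
exact: (ccontM (ccont_cst (r%:C : R[i]^o) t) c).
Qed.

Lemma circle_integrand_continuous (R : realType) (f : R[i]^o -> R[i]^o) (r :
  R) :
  {in unit_disc R, continuous f} -> 0 < r < 1 ->
  continuous (fun t => normc (f (circle_point r t))).
Proof.
move=> cf /andP[r0 r1] t.
have cD : circle_point r t \in unit_disc R.
  by apply/mem_set; rewrite /unit_disc /mkset normc_circle_point// ltW.
have c := continuous_comp (@circle_point_continuous R r t) (cf _ cD).
exact: (continuous_comp c (@normc_continuous R _)).
Qed.

(** The estimates give 400 = 4 * 100; it is rounded up to 512 = 8^3 because a cube root is taken
    later. *)
Lemma cayley_sqr_circle_le (R : realType) (r t : R) : 0 < r < 1 ->
  0 <= t <= pi ->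
  normc (cayley (circle_point r t)) ^+ 2 <= 512 / ((1 - r) + t) ^+ 2.
Proof.
move=> /andP[r0 r1] tpi; have := one_sub_cos_ge tpi; have /andP[t0 t1] := tpi.
have pi4 : pi < 4 :> R by have := pihalf_lt2 R; lra.
have zr := normc_circle_point t (ltW r0).
have := normc_one_sub_circle r t; move: (circle_point r t) zr => z zr zE ct.
have zD : unit_disc R z by rewrite /unit_disc/= zr.
have n0 := exprn_gt0 2 (normc_gt0 (disc_neq1 zD)).
have st0 : 0 < ((1 - r) + t) ^+ 2 by rewrite exprn_gt0//; lra.
(* For r <= 1/2 the term (1 - r)^2 >= 1/4 suffices, since 1 - r + t < 5; this fixes the 100. For
   larger r the cosine term contributes t^2 / 32. *)
have low : ((1 - r) + t) ^+ 2 / 100 <= normc (1 - z) ^+ 2.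
  rewrite zE; have [r2|r2] := leP r 2^-1; first by nra.
  have : t ^+ 2 / 32 <= 2 * r * (1 - cos t) by have := sqr_ge0 t; nra.
  by have := sqr_ge0 t; have := sqr_ge0 (1 - r); have := sqr_ge0 (1 - r - t);
    nra.
have up : normc (1 + z) <= 2.
  apply: le_trans (le_normcD _ _) _.
  by rewrite normc1 zr; lra.
rewrite /cayley normcM normcV exprMn exprVn ler_pdivrMr// mulrAC ler_pdivlMr//.
have : normc (1 + z) ^+ 2 <= 4 by have := normc_ge0 (1 + z); nra.
move: (_ ^+ 2) (_ ^+ 2) (_ ^+ 2) n0 st0 low => n a b; nra.
Qed.

(** On this arc |1 - z|^2 <= 2 (1 - r)^2 <= 1/2, so |1 - z| <= 1, and |1 + z| >= 2 - |1 - z| >=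
    1. *)
Lemma cayley_sqr_circle_ge (R : realType) (r t : R) : 2^-1 <= r < 1 ->
  0 <= t <= 1 - r -> 1 / (4 * (1 - r) ^+ 2) <= normc (cayley (circle_point r
    t)) ^+ 2.
Proof.
move=> /andP[r2 r1] /andP[t0 tr]; have ct := one_sub_cos_le t0.
have r0 : 0 <= r by apply: le_trans r2; rewrite invr_ge0.
have := normc_one_sub_circle r t; have := normc_circle_point t r0.
move: (circle_point r t) => z zr zE.
have zD : unit_disc R z by rewrite /unit_disc/= zr.
have n0 := exprn_gt0 2 (normc_gt0 (disc_neq1 zD)).
have s0 : 0 < (1 - r) ^+ 2 by rewrite exprn_gt0// subr_gt0.
have up : normc (1 - z) ^+ 2 <= 2 * (1 - r) ^+ 2.
  have : t ^+ 2 <= (1 - r) ^+ 2 by rewrite ler_pXn2r ?nnegrE//; lra.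
  rewrite zE; have : 0 <= 1 - cos t by rewrite subr_ge0 cos_le1.
  nra.
have low : 1 <= normc (1 + z) ^+ 2.
  have : normc (1 - z) <= 1.
    rewrite -(ler_pXn2r (n := 2)) ?nnegrE ?normc_ge0// expr1n.
    by apply: le_trans up _; nra.
  have : normc (1 + 1) <= normc (1 + z) + normc (1 - z).
    rewrite (_ : 1 + 1 = (1 + z) + (1 - z)); first exact: le_normcD.
    by ring.
  rewrite (_ : normc (1 + 1) = 2);
    last by rewrite /= addr0 expr0n addr0 sqrtr_sqr ger0_norm.
  by nra.
rewrite /cayley normcM normcV exprMn exprVn ler_pdivlMr// mulrAC ler_pdivrMr;
  last lra.
by nra.
Qed.

Lemma circle_mean_ge (R : realType) (f : R[i]^o -> R[i]^o) (r c d : R) :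
  {in unit_disc R, continuous f} -> 0 < r < 1 -> 0 <= c -> 0 <= d <= 2 * pi ->
  (forall t, 0 <= t <= d -> c <= normc (f (circle_point r t))) ->
  (((2 * pi)^-1 * (c * d))%:E <= circle_mean f r)%E.
Proof.
move=> cf r01 c0 /andP[d0 dpi] fc.
have cont := circle_integrand_continuous cf r01.
have mf (D : set (measurableTypeR R)) : measurable_fun D
    (fun t => (normc (f (circle_point r t)))%:E).
  apply: measurableT_comp => //; apply: measurable_funTS.
  exact: (continuous_measurable_fun cont).
have mI x : measurable (`[0, x]%classic : set R) by exact: measurable_itv.
rewrite /circle_mean EFinM lee_pmul2l ?lte_fin ?invr_gt0 ?mulr_gt0 ?pi_gt0//.
apply: (@le_trans _ _ (\int[@lebesgue_measure R]_(t in `[0%R, d])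
    (normc (f (circle_point r t)))%:E)%E); last first.
  apply: ge0_subset_integral => //.
    by move=> t _; rewrite lee_fin normc_ge0.
  by move=> t; rewrite /= !in_itv/= => /andP[-> td]; exact: le_trans dpi.
apply: (@le_trans _ _ (\int[@lebesgue_measure R]_(t in `[0%R, d]) c%:E)%E).
  have E : @lebesgue_measure R `[0, d]%classic = d%:E.
    rewrite lebesgue_measure_itv/= lte_fin; have [_|d0'] := ltP 0 d.
      by rewrite oppr0 adde0.
    by congr EFin; apply/eqP; rewrite eq_le d0.
  by rewrite integral_cst//= [X in (_ * X)%E]E.
apply: ge0_le_integral => //.
Qed.

Lemma cayley_sqr_unbounded_means (R : realType) :
  ~ bounded_circle_means (fun z : R[i]^o => cayley z ^+ 2).
Proof.
rewrite /bounded_circle_means; set S := [set _ | _ in _].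
pose g (z : R[i]^o) : R[i]^o := cayley z ^+ 2.
suff big (x : R) : exists2 r : R, 0 < r < 1 & (x%:E <= circle_mean g r)%E.
  have ub (x : R) : (x%:E <= ereal_sup S)%E.
    have [r r01 xr] := big x; apply: le_trans xr _.
    by apply: ereal_sup_ubound; exists r.
  case: (ereal_sup S) ub => [a||] ub //; last by have := ub 0.
  by have := ub (a + 1); rewrite lee_fin gerDl ler10.
have cg : {in unit_disc R, continuous g}.
  move=> z; rewrite inE => zD; have c := cayley_continuous (disc_neq1 zD).
  exact: (ccontM c c).
have pi2 := pi_ge2 R; have y1 : 1 <= `|x| + 1 by rewrite lerDr.
(* With r = 1 - s and an arc of length s, the lower bound for the mean is 1 / (8 pi s), which this
   choice makes equal to |x| + 1. *)
pose s := (8 * pi * (`|x| + 1))^-1.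
have s0 : 0 < s by rewrite invr_gt0; nra.
have s2 : s <= 2^-1 by rewrite lef_pV2 ?posrE; nra.
have r01 : 0 < 1 - s < 1 by lra.
exists (1 - s) => //.
apply: (@le_trans _ _ ((2 * pi)^-1 * ((1 / (4 * s ^+ 2)) * s))%:E).
  rewrite lee_fin (_ : _ * _ = `|x| + 1).
    by apply: le_trans (ler_norm x) _; rewrite lerDl.
  by rewrite /s; field; lra.
apply: circle_mean_ge => //.
- by rewrite divr_ge0// mulr_ge0// sqr_ge0.
- by rewrite (ltW s0)/=; nra.
move=> t ts; rewrite /g [cayley _ ^+ 2]expr2 normcM -expr2.
have := @cayley_sqr_circle_ge R (1 - s) t; rewrite subKr; apply; last exact: ts.
by apply/andP; split; lra.
Qed.

(** * Uniform bound for the circle means of the composition *)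

Definition cbrt_inv_sqr (R : realType) (x : R) : R := cbrt_inv (x ^+ 2).

(** For y > 0 the primitive is 3 y^(1/3), written as 3 y * y^(-2/3) so that only one fractional
    power occurs. *)
Lemma is_derive_cbrt_primitive (R : realType) (x : R) : 0 < x ->
  is_derive x (1 : R) (fun y => 3 * y * cbrt_inv_sqr y) (cbrt_inv_sqr x).
Proof.
move=> x0; have x2 : 0 < x ^+ 2 by rewrite exprn_gt0.
have d1 : is_derive x (1 : R) (fun y => y ^+ 2) (2 * x).
  have := is_deriveX 2 (is_derive_id x (1 : R)).
  by move/is_derive_eq; apply; rewrite /= expr1 /GRing.scale/= mulr1.
have d2 := @is_derive1_comp _ _ (fun y => y ^+ 2) _ _ _ (is_derive_cbrt_inv x2)
  d1.
have d3 : is_derive x (1 : R) (fun y => 3 * y) 3.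
  have := is_derive_affine 0 3 x.
  by under eq_fun do rewrite addr0 mulrC.
have := is_deriveM d3 d2; move/is_derive_eq; apply.
rewrite /cbrt_inv_sqr /GRing.scale/=; field.
by rewrite gt_eqF.
Qed.

Lemma cbrt_inv_sqr_ge0 (R : realType) (x : R) : 0 <= cbrt_inv_sqr x.
Proof. exact: powR_ge0. Qed.

Lemma cbrt_inv_sqrX3 (R : realType) (x : R) : cbrt_inv_sqr x ^+ 3 = (x ^+ 2)^-1.
Proof. exact: cbrt_invK (sqr_ge0 x). Qed.

Lemma cbrt_inv_sqr_continuous (R : realType) (x : R) : 0 < x ->
  {for x, continuous (@cbrt_inv_sqr R)}.
Proof.
move=> x0; have x2 : 0 < x ^+ 2 by rewrite exprn_gt0.
have c1 : {for x ^+ 2, continuous (@cbrt_inv R)}.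
  apply: differentiable_continuous; apply/derivable1_diffP.
  by have [] := is_derive_cbrt_inv x2.
have c2 : {for x, continuous (fun y : R => y ^+ 2)}.
  exact: (cvgM (@cvg_id _ (nbhs x)) (@cvg_id _ (nbhs x))).
exact: (continuous_comp c2 c1).
Qed.

(* For s = 1 - r this is integrable over [0, 2 pi] uniformly in r, while s > 0
   keeps it continuous there. *)
Definition cbrt_majorant (R : realType) (s t : R) : R :=
  8 * (cbrt_inv_sqr (s + t) + cbrt_inv_sqr (s + 2 * pi - t)).

Lemma cbrt_majorant_continuous (R : realType) (s t : R) :
  0 < s -> 0 <= t <= 2 * pi -> {for t, continuous (cbrt_majorant s)}.
Proof.
move=> s0 /andP[t0 t1].
have st : 0 < s + t by lra.
have sp : 0 < s + 2 * pi - t by lra.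
have a1 : {for t, continuous (fun t : R => s + t)}.
  exact: (cvgD (cvg_cst s) (@cvg_id _ (nbhs t))).
have a2 : {for t, continuous (fun t : R => s + 2 * pi - t)}.
  exact: (cvgB (cvg_cst (s + 2 * pi)) (@cvg_id _ (nbhs t))).
have c1 := continuous_comp a1 (cbrt_inv_sqr_continuous st).
have c2 := continuous_comp a2 (cbrt_inv_sqr_continuous sp).
exact: (cvgM (cvg_cst (8 : R)) (cvgD c1 c2)).
Qed.

Lemma integral_cbrt_majorant_le (R : realType) (s : R) : 0 < s <= 1 ->
  (\int[@lebesgue_measure R]_(t in `[0%R, (2 * pi)%R])
     (cbrt_majorant s t)%:E <= 432%:E)%E.
Proof.
move=> /andP[s0 s1]; have pi2 := pi_ge2 R.
have pi4 : pi < 4 :> R by have := pihalf_lt2 R; lra.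
pose Psi (x : R) := 3 * x * cbrt_inv_sqr x.
pose F t := 8 * (Psi (s + t) - Psi (s + 2 * pi - t)).
pose G := cbrt_majorant s.
have dF (t : R) : 0 <= t <= 2 * pi -> is_derive t (1 : R) F (G t).
  move=> /andP[t0 t1].
  have st : 0 < s + t by lra.
  have sp : 0 < s + 2 * pi - t by lra.
  have a1 : is_derive t (1 : R) (fun t => s + t) 1.
    have := is_derive_affine s 1 t.
    by under eq_fun do rewrite mulr1 addrC.
  have a2 : is_derive t (1 : R) (fun t => s + 2 * pi - t) (-1).
    have := is_derive_affine (s + 2 * pi) (-1) t.
    by under eq_fun do rewrite mulrN1 addrC.
  have d1 := @is_derive1_comp _ _ (fun t => s + t) _ _ _
    (is_derive_cbrt_primitive st) a1.
  have d2 := @is_derive1_comp _ _ (fun t => s + 2 * pi - t) _ _ _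
    (is_derive_cbrt_primitive sp) a2.
  have := is_deriveZ 8 (is_deriveB d1 d2); move/is_derive_eq; apply.
  by rewrite /G /cbrt_majorant /GRing.scale/= mulr1 mulrN1 opprK.
have cF (t : R) : 0 <= t <= 2 * pi -> {for t, continuous F}.
  move=> tI; apply: differentiable_continuous; apply/derivable1_diffP.
  by have [] := dF t tI.
rewrite (@continuous_FTC2 _ G F); first last.
- move=> t; rewrite in_itv/= => /andP[t0 t1].
  by rewrite derive1E; have [|_ ->//] := dF t; rewrite !ltW.
- split => [t|| ].
  + by rewrite in_itv/= => /andP[t0 t1]; have [|//] := dF t; rewrite !ltW.
  + by apply: cvg_at_right_filter; apply: cF; rewrite lexx; lra.
  + by apply: cvg_at_left_filter; apply: cF; rewrite lexx andbT; lra.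
- by apply: continuous_in_subspaceT => t; rewrite inE/= in_itv/=;
  exact: cbrt_majorant_continuous.
- lra.
rewrite -EFinB lee_fin /F /Psi.
have -> : s + 2 * pi - 2 * pi = s by ring.
have -> : s + 2 * pi - 0 = s + 2 * pi by ring.
rewrite addr0.
(* The difference of the values of F is 16 (Psi (s + 2 pi) - Psi s) <= 48 (s + 2 pi) (s + 2
   pi)^(-2/3). The last factor is at most 1 and s + 2 pi < 9, whence 432 = 48 * 9. *)
have b0 := cbrt_inv_sqr_ge0 s; have b1 := cbrt_inv_sqr_ge0 (s + 2 * pi).
have : cbrt_inv_sqr (s + 2 * pi) <= 1.
  rewrite -(ler_pXn2r (n := 3)) ?nnegrE// cbrt_inv_sqrX3 expr1n invf_le1
    ?exprn_gt0//; last lra.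
  by rewrite expr_ge1//; lra.
by nra.
Qed.

Lemma circle_mean_le (R : realType) (f : R[i]^o -> R[i]^o) (r : R) :
  {in unit_disc R, continuous f} -> 0 < r < 1 ->
  (forall t, 0 <= t <= 2 * pi ->
    normc (f (circle_point r t)) <= cbrt_majorant (1 - r) t) ->
  (circle_mean f r <= ((2 * pi)^-1 * 432)%:E)%E.
Proof.
move=> cf r01 fle; have /andP[r0 r1] := r01.
have cont := circle_integrand_continuous cf r01.
rewrite /circle_mean EFinM lee_pmul2l ?lte_fin ?invr_gt0 ?mulr_gt0 ?pi_gt0//.
have mI : measurable (`[0, 2 * pi]%classic : set R) by exact: measurable_itv.
have s01 : 0 < 1 - r <= 1 by lra.
apply: le_trans (integral_cbrt_majorant_le s01).
apply: ge0_le_integral => //.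
- by move=> t _; rewrite lee_fin normc_ge0.
- apply: measurableT_comp => //; apply: measurable_funTS.
  exact: (continuous_measurable_fun cont).
- apply: measurableT_comp => //;
  apply: subspace_continuous_measurable_fun => //.
  apply: continuous_in_subspaceT => t; rewrite inE/= in_itv/= => tI.
  by apply: cbrt_majorant_continuous => //; lra.
Qed.

Lemma circle_point_conj (R : realType) (r t : R) :
  circle_point r (2 * pi - t) = (circle_point r t)^*%C.
Proof.
rewrite /circle_point conjM conjc_real; congr (_ * _).
have -> : 2 * pi - t = - t + pi *+ 2 by rewrite mulr2n; ring.
by rewrite cosD2pi sinD2pi cosN sinN.
Qed.

Lemma cayley_conj (R : realType) (z : R[i]) : cayley z^*%C = (cayley z)^*%C.
Proof. by rewrite /cayley conjM conjc_inv rmorphB rmorphD rmorph1. Qed.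

(** The cube of |P(W)|^2 is |W|^2, so the bound on |W|^2 is compared after cubing. It covers t <=
    pi; for larger t, complex conjugation moves the point to 2 pi - t without changing |W|, which is
    why the majorant has two terms. *)
Lemma radial_cayley_sqr_le (R : realType) (r t : R) :
  0 < r < 1 -> 0 <= t <= 2 * pi ->
  normc (radial_cbrt (cayley (circle_point r t)) ^+ 2) <= cbrt_majorant (1 - r)
    t.
Proof.
move=> r01 /andP[t0 t1]; have /andP[r0 r1] := r01.
have key (u : R) : 0 <= u <= pi ->
    normc (cayley (circle_point r t)) = normc (cayley (circle_point r u)) ->
    normc (radial_cbrt (cayley (circle_point r t)) ^+ 2) <=
      8 * cbrt_inv_sqr (1 - r + u).
  move=> uI tu; have := cayley_sqr_circle_le r01 uI.
  rewrite -tu -normc_radial_cbrtX3 -exprM mulnC exprM => E.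
  rewrite expr2 normcM -expr2 -(ler_pXn2r (n :=
    3)) ?nnegrE ?sqr_ge0 ?mulr_ge0 ?cbrt_inv_sqr_ge0//.
  by rewrite [leRHS]exprMn cbrt_inv_sqrX3 (_ : 8 ^+ 3 = 512)//; ring.
have b0 := cbrt_inv_sqr_ge0 (1 - r + t).
have b1 := cbrt_inv_sqr_ge0 (1 - r + 2 * pi - t).
rewrite /cbrt_majorant mulrDr; have [tpi|tpi] := leP t pi.
  apply: le_trans (key t _ erefl) _; first by rewrite t0 tpi.
  by rewrite lerDl mulr_ge0.
apply: le_trans (key (2 * pi - t) _ _) _.
- by apply/andP; split; lra.
- by rewrite circle_point_conj cayley_conj normc_conjc.
- by rewrite addrA lerDr mulr_ge0.
Qed.

Lemma analytic_cayley_sqr (R : realType) :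
  analytic (fun z : R[i]^o => cayley z ^+ 2).
Proof.
move=> z zD; have z1 := disc_neq1 zD.
have d1 : derivable (fun w : R[i]^o => 1 - w) z 1.
  by apply: derivableB; [exact: derivable_cst|exact: derivable_id].
have d2 : derivable (fun w : R[i]^o => 1 + w) z 1.
  by apply: derivableD; [exact: derivable_cst|exact: derivable_id].
have d3 : derivable (@cayley R) z 1.
  exact: (derivableM d2 (@derivableV _ _ (fun w : R[i]^o => 1 - w) _ _ z1 d1)).
exact: (derivableM d3 d3).
Qed.

Theorem theorem2 (R : realType) :
  exists g phi : R[i]^o -> R[i]^o,
    [/\ analytic g,
        quasiconformal phi /\ phi @` unit_disc R = unit_disc R,
        H1qr (g \o phi),
        (exists Phi Psi : R[i]^o -> R[i]^o,
           closed_disc_extension phi Phi Psi /\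
           [lipschitz Psi w | w in unit_circle R]) &
        ~ H1 g].
Proof.
pose g (z : R[i]^o) : R[i]^o := cayley z ^+ 2.
exists g, (@stretch R); split.
- exact: analytic_cayley_sqr.
- by split; [exact: stretch_quasiconformal|exact: stretch_image].
- have [p [q sqr]] := stretch_C1_quasiregular R.
  have cg : {in unit_disc R, continuous g}.
    move=> z; rewrite inE => zD; have c := cayley_continuous (disc_neq1 zD).
    exact: (ccontM c c).
  pose dg (z : R[i]^o) : R[i]^o := 2 * cayley z * cayley_dz z.
  have cdg : {in unit_disc R, continuous dg}.
    move=> z; rewrite inE => zD; have c := cayley_continuous (disc_neq1 zD).
    have c' := cayley_dz_continuous (disc_neq1 zD).
    exact: (ccontM (ccontM (ccont_cst (2 : R[i]^o) z) c) c').
  have wg z : unit_disc R z -> wirtinger g z (dg z) 0.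
    move=> zD; have := wirtinger_comp (wirtinger_cayley (disc_neq1 zD))
      (@wirtinger_sqr R (cayley z)).
    by rewrite mulr0.
  have gqr := C1_quasiregular_comp sqr (@stretch_disc R) cg cdg wg.
  split; first by exists 3; [lra|exact: (C1_quasiregularW gqr)].
  have [cf _ _ _ _] := gqr.
  apply: (@le_lt_trans _ _ ((2 * pi)^-1 * 432)%:E); last exact: ltry.
  apply: ub_ereal_sup => _ [r /= r01 <-]; apply: circle_mean_le => // t tI.
  have zD : unit_disc R (circle_point r t).
    have /andP[r0 r1] := r01.
    by rewrite /unit_disc /mkset normc_circle_point// ltW.
  have -> : (g \o @stretch R) (circle_point r t) =
      radial_cbrt (cayley (circle_point r t)) ^+ 2.
    congr (_ ^+ 2); apply: cayley_invK.
    exact: (cayley_inv_disc (radial_cbrt_right (cayley_right zD))).1.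
  exact: radial_cayley_sqr_le.
- exists (disc_map (@radial_cbrt R)), (disc_map (@radial_cube R)).
  by split; [exact: stretch_extension|exact: disc_map_cube_lipschitz].
- by move=> [_]; exact: cayley_sqr_unbounded_means.
Qed.
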